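(* Let $\pi$ be any classical pattern, i.e. any permutation, and let $f$ and $g$ be the polynomial functions associated with $\pi$ (i.e. with the vincular pattern $(\pi,\emptyset)$) as described in the context. Then for any $(p_1,p_2)\in\mathbb{R}_+^2$ with $p_1+2p_2\le 1$, except $(p_1,p_2)=(1,0)$, we have $$f(p_1)+p_2\,g(p_1)>0.$$
   Context: Write $[n]=\{1,\dots,n\}$ and let $\mathbb{R}_+$ be the set of nonnegative real numbers. Let $k$ denote the size of the classical pattern $\pi$ (a permutation of $[k]$). An occurrence of $\pi$ in a permutation $\sigma=\sigma_1\cdots\sigma_n$ is a tuple $(i_1,\dots,i_k)$ of elements of $[n]$ with $i_1<\cdots<i_k$ and $\sigma_{i_{\pi^{-1}_1}}<\cdots<\sigma_{i_{\pi^{-1}_k}}$, i.e. $(\sigma_{i_1},\dots,\sigma_{i_k})$ is in the same relative order as $(\pi_1,\dots,\pi_k)$. (This is the case of a vincular pattern $(\pi,A)$ with $A=\emptyset$, meaning that no positions are required to be consecutive.) $X^{\pi}(\sigma)$ is the number of occurrences of $\pi$ in $\sigma$. For an integer partition $\lambda$ of $n$, $\sigma_\lambda$ is a uniform random permutation in the conjugacy class of permutations of cycle type $\lambda$ in the symmetric group $S_n$, and $m_i(\lambda)$ is the number of parts of $\lambda$ equal to $i$. Definition of $f$ and $g$: for each classical pattern $\pi$ of size $k$ there exist two polynomial functions $f,g$ such that, for every sequence $(\lambda^n)_{n\ge1}$ of partitions ($\lambda^n$ a partition of $n$) with $m_1(\lambda^n)/n\to p_1$ and $m_2(\lambda^n)/n\to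 p_2$, one has $$\frac{X^{\pi}(\sigma_{\lambda^n})-\mathbb{E}(X^{\pi}(\sigma_{\lambda^n}))}{n^{k-\frac12}}\xrightarrow[n\to\infty]{d}\mathcal{N}\big(0,f(p_1)+p_2g(p_1)\big),$$ with convergence of all moments. These are the functions $f$ and $g$ in the claim; thus $f(p_1)+p_2g(p_1)=\lim_{n\to\infty} n^{-(2k-1)}\operatorname{Var}(X^\pi(\sigma_{\lambda^n}))$.
   Formalization: The pattern is required to have size at least 2: for a pattern of size 0 or 1 the number of occurrences is deterministic (1 or n), so f(p1)+p2 g(p1)=0 and the claim fails. *)

(* Defs.v *)
From HB Require Import structures.
From mathcomp Require Import all_boot all_order all_algebra all_fingroup.
From mathcomp Require Import all_classical all_reals all_analysis.
Set Implicit Arguments.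
Unset Strict Implicit.
Unset Printing Implicit Defensive.
Import Order.TTheory GRing.Theory Num.Theory.
Import numFieldNormedType.Exports.
Local Open Scope ring_scope.

Record intpart (n : nat) := IntPart {
  parts :> seq nat;
  _ : [&& sorted geq parts, 0%N \notin parts & sumn parts == n] }.

Definition mult (i n : nat) (lam : intpart n) : nat := count_mem i lam.

(* [porbits s] contains the fixed points of [s] as singleton orbits. *)
Definition cycle_class (n : nat) (lam : intpart n) : {set 'S_n} :=
  [set s : 'S_n | perm_eq lam [seq #|(c : {set 'I_n})| | c <- enum (porbits s)]].

(* Positions and values are numbered from 0. *)
Definition occurrence (k n : nat) (tau : 'S_k) (s : 'S_n)
    (i : k.-tuple 'I_n) : bool :=
  [forall a : 'I_k, forall b : 'I_k, (a < b)%N ==>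
     (tnth i a < tnth i b)%N &&
     (s (tnth i ((tau^-1)%g a)) < s (tnth i ((tau^-1)%g b)))%N].

Definition nocc (k n : nat) (tau : 'S_k) (s : 'S_n) : nat :=
  #|[set i : k.-tuple 'I_n | occurrence tau s i]|.

Section Asymptotics.
Local Open Scope classical_set_scope.
Local Open Scope ring_scope.
Variable R : realType.

(* Probability and expectation for a uniform random element of
   [cycle_class lam], which is nonempty for every [lam]. *)
Definition class_prob (n : nat) (lam : intpart n) (A : pred 'S_n) : R :=
  #|[set s in cycle_class lam | A s]%SET|%:R / #|cycle_class lam|%:R.

Definition class_mean (n : nat) (lam : intpart n) (Y : 'S_n -> R) : R :=
  (\sum_(s in cycle_class lam) Y s) / #|cycle_class lam|%:R.

Definition normalized_nocc (k n : nat) (tau : 'S_k) (lam : intpart n)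
    (s : 'S_n) : R :=
  ((nocc tau s)%:R - class_mean lam (fun s' => (nocc tau s')%:R))
    / (n%:R `^ (k%:R - 2^-1)).

(* The law N(0, v), where v is the variance, whereas [normal_prob] takes the
   standard deviation. N(0, 0) is the point mass at 0, which [normal_prob] does
   not provide; negative v get the same, irrelevant, value. *)
Definition centered_normal (v : R) : probability (measurableTypeR R) R :=
  if 0 < v
  then (normal_prob 0 (Num.sqrt v) : probability (measurableTypeR R) R)
  else (\d_(0 : measurableTypeR R) : probability (measurableTypeR R) R).

(* Convergence in distribution is convergence of the distribution functions at
   every continuity point x of the limiting one, i.e. where nu has no atom. *)
Definition cvg_in_distribution (k : nat) (tau : 'S_k)
    (lam : forall n, intpart n) (nu : probability (measurableTypeR R) R) :=
  forall x : R, nu [set x] = 0%E ->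
    class_prob (lam n) (fun s => normalized_nocc tau (lam n) s <= x)
      @[n --> \oo] --> fine (nu `]-oo, x]%classic).

Definition cvg_moments (k : nat) (tau : 'S_k)
    (lam : forall n, intpart n) (nu : probability (measurableTypeR R) R) :=
  forall m : nat,
    class_mean (lam n) (fun s => normalized_nocc tau (lam n) s ^+ m)
      @[n --> \oo] --> Rintegral nu setT (fun x => x ^+ m).

(* This determines f(p1) + p2 g(p1) whenever p1, p2 >= 0 and p1 + 2 p2 <= 1,
   since every such (p1, p2) arises from some sequence of partitions. *)
Definition associated_polys (k : nat) (tau : 'S_k) (f g : {poly R}) :=
  forall (p1 p2 : R) (lam : forall n, intpart n),
    ((mult 1 (lam n))%:R / n%:R : R) @[n --> \oo] --> p1 ->
    ((mult 2 (lam n))%:R / n%:R : R) @[n --> \oo] --> p2 ->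
    let nu := centered_normal (f.[p1] + p2 * g.[p1]) in
    cvg_in_distribution tau lam nu /\ cvg_moments tau lam nu.

End Asymptotics.

(* Main.v *)
Require Import Defs.
From mathcomp Require Import all_boot all_order all_algebra all_fingroup.
From mathcomp Require Import zify ring lra.
Import Order.TTheory GRing.Theory Num.Theory.

(** Suppose that f(p1) + p2 g(p1) <= 0. The limit law is then the point mass at 0,
    so for every sequence of cycle types with densities p1 and p2 of fixed points
    and 2-cycles the variance of the number X of occurrences is o(n^(2k-1)). This is
    contradicted by a lower bound for the variance in every conjugacy class with at
    least c n labels in cycles of a fixed even length l ([class_variance_ge]). For
    the theorem take l = 2 if p2 > 0; otherwise p1 < 1, and the labels that are not
    fixed can be put into 4-cycles ([partitions_exist]).

    The lower bound comes from the covariance of X with a statistic Y of variance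
    O(n): if |Cov(X, Y)| >= c n^k, then Var(X) >= c' n^(2k-1) by Cauchy-Schwarz.
    Let Y count, up to centering, the l-cycles all of whose points (i, s(i)) lie
    close to certain corners of the square [0, n] x [0, n]. Given that some labels
    form an l-cycle, split X into the occurrences that use this cycle and the
    others. Conjugating by a bijection that moves these labels anywhere else but is
    increasing on the remaining ones shows that the mean of the second part is the
    same for all positions of the cycle ([class_off_const]). So Cov(X, Y) compares
    the number of occurrences using a cycle in the corners with that number for a
    typical cycle. For a typical cycle it is of order n^(k-1), because a positive
    fraction of all k-tuples of points in l-cycles are occurrences
    ([class_sum_occ_at_ge]). For a cycle in well chosen corners it is only a small
    multiple of n^(k-1) ([occ_at_corner]): an occurrence using a point next to a
    corner has another point squeezed between this point and the border, unless the
    pattern itself has an entry in that corner. If the pattern does not start with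
    its least value, the corner (0, 0) will do; if it does, then it has no entry in
    the corners (0, n) and (n, 0), and a cycle of even length can alternate between
    small and large labels, which puts all its points in these two corners.

    That Var(Y) = O(n) is a second moment computation using that disjoint pairs of
    tuples of labels are all equally likely to be pairs of cycles
    ([sum_corner_excess_sqr]). *)

Set Implicit Arguments.
Unset Strict Implicit.
Unset Printing Implicit Defensive.

(** * Counting functions with constraints *)

Lemma leq_card_bigcup_sum (I T : finType) (B : I -> {set T}) (P : pred I) :
  #|\bigcup_(i | P i) B i| <= \sum_(i | P i) #|B i|.
Proof.
elim/big_rec2: _ => [|u X s _ IH]; first by rewrite cards0.
by apply: (leq_trans (leq_card_setU _ _)); rewrite leq_add2l.
Qed.

Lemma leq_card_bigcup (I T : finType) (B : I -> {set T}) (P : pred I) (c : nat) :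
  (forall i, P i -> #|B i| <= c) -> #|\bigcup_(i | P i) B i| <= #|P| * c.
Proof.
move=> Bc; apply: (leq_trans (leq_card_bigcup_sum _ _)).
by rewrite -sum_nat_const; apply: leq_sum.
Qed.

Lemma card_family_prod (I T : finType) (F : I -> {set T}) :
  #|[set f : {ffun I -> T} | [forall c, f c \in F c]]| = \prod_c #|F c|.
Proof.
transitivity #|family (fun c => mem (F c))|.
  rewrite cardsE; apply: eq_card => f; rewrite !inE.
  by apply/forallP/familyP.
by rewrite card_family foldrE big_map big_enum.
Qed.

Lemma card_ffun_at (m : nat) (T : finType) (a : 'I_m) (x : T) :
  #|[set f : {ffun 'I_m -> T} | f a == x]| = #|T| ^ (m - 1).
Proof.
pose F c := if c == a then [set x] else [set: T].
transitivity #|[set f : {ffun 'I_m -> T} | [forall c, f c \in F c]]|.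
  apply: eq_card => f; rewrite !inE; apply/eqP/forallP => [fx c | /(_ a)].
    by rewrite /F; case: (c =P a) => [->|_]; rewrite inE ?fx.
  by rewrite /F eqxx inE => /eqP.
rewrite card_family_prod (bigD1 a) //= /F eqxx cards1 mul1n.
rewrite (eq_bigr (fun=> #|T|)) => [|c /negPf->]; last by rewrite cardsT.
by rewrite prod_nat_const cardC1 card_ord subn1.
Qed.

Lemma card_ffun_pair (m : nat) (T : finType) (a b : 'I_m) (U : {set T * T}) :
  a != b ->
  #|[set f : {ffun 'I_m -> T} | (f a, f b) \in U]| <= #|U| * #|T| ^ (m - 2).
Proof.
move=> ab.
pose F (u : T * T) c :=
  if c == a then [set u.1] else if c == b then [set u.2] else [set: T].
pose B u := [set f : {ffun 'I_m -> T} | [forall c, f c \in F u c]].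
have cB u : #|B u| = #|T| ^ (m - 2).
  rewrite card_family_prod (bigD1 a) //= (bigD1 b) 1?eq_sym //= /F eqxx.
  rewrite (eq_sym b) (negPf ab) eqxx !cards1 !mul1n.
  rewrite (eq_bigr (fun=> #|T|)) => [|c /andP[/negPf-> /negPf->]]; last first.
    by rewrite cardsT.
  rewrite prod_nat_const; congr (_ ^ _).
  have -> : #|[pred i | (i != a) && (i != b)]| = #|~: [set a; b]|.
    by apply: eq_card => c; rewrite !inE negb_or.
  by have := cardsC [set a; b]; rewrite cards2 ab card_ord; lia.
have sub : [set f : {ffun 'I_m -> T} | (f a, f b) \in U]
    \subset \bigcup_(u in U) B u.
  apply/subsetP => f; rewrite inE => fU; apply/bigcupP; exists (f a, f b) => //.
  rewrite inE; apply/forallP => c; rewrite /F /=.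
  by case: eqP => [->|_]; [|case: eqP => [->|_]]; rewrite inE.
apply: (leq_trans (subset_leq_card sub)).
by apply: leq_card_bigcup => u _; rewrite cB.
Qed.

Lemma card_not_injective (m : nat) (T : finType) :
  #|[set f : {ffun 'I_m -> T} | ~~ injectiveb f]| <= m ^ 2 * #|T| ^ (m - 1).
Proof.
pose B (ab : 'I_m * 'I_m) := [set f : {ffun 'I_m -> T} | f ab.1 == f ab.2].
pose Q := [set ab : 'I_m * 'I_m | ab.1 != ab.2].
have sub : [set f : {ffun 'I_m -> T} | ~~ injectiveb f]
    \subset \bigcup_(u in Q) B u.
  apply/subsetP => f; rewrite inE => /injectivePn[a [b ab fab]].
  by apply/bigcupP; exists (a, b); rewrite inE //= fab.
apply: (leq_trans (subset_leq_card sub)).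
apply: (@leq_trans (#|Q| * #|T| ^ (m - 1))); last first.
  rewrite leq_mul2r; apply/orP; right.
  by apply: (leq_trans (max_card _)); rewrite card_prod card_ord mulnn.
apply: leq_card_bigcup => -[a b]; rewrite inE /= => ab.
have -> : B (a, b) =
    [set f : {ffun 'I_m -> T} | (f a, f b) \in [set (x, x) | x : T]].
  apply/setP => f; rewrite !inE /=; apply/eqP/imsetP => [->|[x _ [-> ->//]]].
  by exists (f b).
apply: (leq_trans (card_ffun_pair _ ab)).
rewrite card_imset; last by move=> x y [].
have := ltn_ord a; have := ltn_ord b; move: ab; rewrite -val_eqE /=.
move=> ab' bm am; have -> : m - 1 = (m - 2).+1 by lia.
by rewrite expnS cardT.
Qed.

Lemma card_ord_lt (n e : nat) : e <= n -> #|[set x : 'I_n | x < e]| = e.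
Proof.
move=> en.
transitivity #|[set widen_ord en y | y in [set: 'I_e]]|.
  apply: eq_card => x; rewrite inE; apply/idP/imsetP => [xe|[y _ ->]//=].
  by exists (Ordinal xe) => //; apply: val_inj.
rewrite card_imset ?cardsT ?card_ord // => x y /(congr1 val) /= xy.
exact: val_inj.
Qed.

(** Relabelling along [r] carries the tuple [l] to [l'] while the labels outside
    [l] keep their relative order: list the labels as [l] followed by its
    complement in increasing order, do the same for [l'], and match the lists. *)
Lemma perm_extend (n : nat) (l l' : seq 'I_n) :
  uniq l -> uniq l' -> size l = size l' ->
  exists r : 'S_n, map r l = l' /\
    {in [predC l] &, forall x y : 'I_n, (x < y)%N -> (r x < r y)%N}.
Proof.
move=> ul ul' sl.
pose c (u : seq 'I_n) := [seq x <- enum 'I_n | x \notin u].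
have cU (u : seq 'I_n) : uniq u -> perm_eq (u ++ c u) (enum 'I_n).
  move=> uu; rewrite perm_sym -(perm_filterC (mem u) (enum 'I_n)).
  apply: perm_cat => //.
  apply: uniq_perm => //; first exact/filter_uniq/enum_uniq.
  by move=> x; rewrite mem_filter mem_enum andbT.
have sz (u : seq 'I_n) : uniq u -> size (u ++ c u) = n.
  by move=> uu; rewrite (perm_size (cU _ uu)) size_enum_ord.
have memU (u : seq 'I_n) : uniq u -> u ++ c u =i predT.
  by move=> uu x; rewrite (perm_mem (cU _ uu)) mem_enum.
have uU (u : seq 'I_n) : uniq u -> uniq (u ++ c u).
  by move=> uu; rewrite (perm_uniq (cU _ uu)) enum_uniq.
pose f x := nth x (l' ++ c l') (index x (l ++ c l)).
have fi : injective f.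
  move=> x y; rewrite /f => e.
  have ix z : index z (l ++ c l) < size (l' ++ c l').
    by rewrite (sz l' ul') -[X in _ < X](sz l ul) index_mem memU.
  move: e; rewrite (set_nth_default y) // => /eqP.
  rewrite nth_uniq ?uU // => /eqP e.
  by rewrite -(nth_index y (_ : x \in l ++ c l)) ?memU // e nth_index ?memU.
have szc : size (c l) = size (c l').
  by apply/eqP; rewrite -(eqn_add2l (size l)) {2}sl -!size_cat !sz.
have srt u : sorted (fun x y : 'I_n => x < y) (c u).
  apply: sorted_filter; first by move=> x y z; apply: ltn_trans.
  by have := iota_ltn_sorted 0 n; rewrite -val_enum_ord sorted_map.
exists (perm fi); split.
  case: l l' ul ul' sl @f fi {szc} => [|x0 l0] [|x0' l0'] // ul ul' sl f fi.
  apply: (@eq_from_nth _ x0); rewrite size_map // => i il.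
  rewrite (nth_map x0) // permE /f index_cat mem_nth // index_uniq //.
  by rewrite nth_cat -sl il; apply: set_nth_default; rewrite -sl.
move=> x y; rewrite !inE => xl yl xy; rewrite !permE /f !index_cat.
rewrite (negPf xl) (negPf yl) !nth_cat -sl !ltnNge !leq_addr /= -ltnNge.
rewrite !addKn.
have xc : x \in c l by rewrite mem_filter xl mem_enum.
have yc : y \in c l by rewrite mem_filter yl mem_enum.
rewrite (set_nth_default y); last by rewrite -szc index_mem.
have tr : transitive (fun x y : 'I_n => x < y) by move=> ? ? ?; apply: ltn_trans.
have := @sorted_ltn_nth _ _ tr y (c l') (srt l').
apply; rewrite ?inE -?szc ?index_mem //.
rewrite ltnNge; apply/negP => le.
have := @sorted_leq_nth _ (fun x y : 'I_n => x <= y).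
move=> /(_ (fun a b c => @leq_trans _ _ _) (fun a => leqnn _) y (c l)).
have: sorted (fun x y : 'I_n => x <= y) (c l).
  by apply: sub_sorted (srt l) => a b; apply: ltnW.
move=> s /(_ s _ _ _ _ le); rewrite !inE !index_mem yc xc => /(_ isT isT).
by rewrite !nth_index // leqNgt xy.
Qed.

(** * Cycles and the occurrences that use them *)

Definition is_cycle (L n : nat) (s : 'S_n) (t : {ffun 'I_L -> 'I_n}) : bool :=
  injectiveb t && [forall a, s (t a) == t (ordS a)].

(** The labels of a cycle are closed under the permutation, so an occurrence
    with no position in the cycle has no value in it either. *)
Definition meets (L k n : nat) (t : {ffun 'I_L -> 'I_n}) (i : k.-tuple 'I_n) :=
  [exists a, exists b, tnth i b == t a].

Definition occ_at (L k n : nat) (tau : 'S_k) (s : 'S_n)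
    (t : {ffun 'I_L -> 'I_n}) : nat :=
  #|[set i : k.-tuple 'I_n | occurrence tau s i && meets t i]|.

Definition occ_off (L k n : nat) (tau : 'S_k) (s : 'S_n)
    (t : {ffun 'I_L -> 'I_n}) : nat :=
  #|[set i : k.-tuple 'I_n | occurrence tau s i && ~~ meets t i]|.

Lemma nocc_split (L k n : nat) (tau : 'S_k) (s : 'S_n)
    (t : {ffun 'I_L -> 'I_n}) :
  nocc tau s = occ_at tau s t + occ_off tau s t.
Proof.
rewrite /nocc -(cardsID [set i | meets t i]); congr (_ + _).
  by apply: eq_card => i; rewrite !inE.
by apply: eq_card => i; rewrite !inE andbC.
Qed.

Lemma is_cycle_iter (L n : nat) (s : 'S_n) (t : {ffun 'I_L.+1 -> 'I_n})
    (a : 'I_L.+1) :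
  is_cycle s t -> t a = iter a s (t ord0).
Proof.
case/andP=> _ /forallP st; case: a => m mL /=.
elim: m mL => [|m IH] mL; first by congr (t _); apply: val_inj.
rewrite iterS -(IH (ltnW mL)); have /eqP-> := st (Ordinal (ltnW mL)).
by congr (t _); apply: val_inj; rewrite /= modn_small.
Qed.

Lemma is_cycle_mem (L n : nat) (s : 'S_n) (t : {ffun 'I_L -> 'I_n}) (x : 'I_n) :
  is_cycle s t -> (s x \in codom t) = (x \in codom t).
Proof.
case/andP=> _ /forallP st; apply/codomP/codomP => -[a e].
  exists (ord_pred a); apply: (@perm_inj _ s); rewrite e.
  by rewrite (eqP (st _)) ord_predK.
by exists (ordS a); rewrite e (eqP (st _)).
Qed.

Lemma is_cycle_inj (L n : nat) (s : 'S_n) (t u : {ffun 'I_L.+1 -> 'I_n}) :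
  is_cycle s t -> is_cycle s u -> t ord0 = u ord0 -> t = u.
Proof.
by move=> ct cu e; apply/ffunP => a; rewrite (is_cycle_iter _ ct) e -is_cycle_iter.
Qed.

Lemma card_is_cycle_le (L n : nat) (s : 'S_n) :
  #|[set t : {ffun 'I_L.+1 -> 'I_n} | is_cycle s t]| <= n.
Proof.
pose h (t : {ffun 'I_L.+1 -> 'I_n}) := t ord0.
rewrite -[leqRHS]card_ord -(card_in_imset (f := h)).
  exact: max_card.
by move=> t u; rewrite !inE; apply: is_cycle_inj.
Qed.

Definition touch (L n : nat) (t u : {ffun 'I_L -> 'I_n}) :=
  [exists a, exists b, u b == t a].

(** A cycle of [s] that shares a label with the cycle [t] is one of its
    rotations. *)
Lemma card_is_cycle_meeting (L n : nat) (s : 'S_n)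
    (t : {ffun 'I_L.+1 -> 'I_n}) :
  is_cycle s t ->
  #|[set u : {ffun 'I_L.+1 -> 'I_n} |
      is_cycle s u && touch t u]| <= L.+1.
Proof.
move=> ct.
pose h (u : {ffun 'I_L.+1 -> 'I_n}) := u ord0.
rewrite -(card_in_imset (f := h)); last first.
  move=> u v; rewrite !inE => /andP[cu _] /andP[cv _].
  exact: (is_cycle_inj cu cv).
apply: (@leq_trans #|codom t|).
  apply/subset_leq_card/subsetP => x /imsetP[u]; rewrite inE => /andP[cu].
  case/existsP=> a /existsP[b /eqP e] ->; rewrite /h.
  have: u b \in codom t by rewrite e codom_f.
  rewrite (is_cycle_iter b cu); elim: (b : nat) => //= m IH.
  by rewrite is_cycle_mem.
by apply: (leq_trans (card_size _)); rewrite size_codom card_ord.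
Qed.

Definition relabel (L n : nat) (r : 'S_n) (t : {ffun 'I_L -> 'I_n}) :
  {ffun 'I_L -> 'I_n} := [ffun a => r (t a)].

Lemma is_cycleJ (L n : nat) (s r : 'S_n) (t : {ffun 'I_L -> 'I_n}) :
  is_cycle (s ^ r)%g (relabel r t) = is_cycle s t.
Proof.
congr (_ && _).
  apply/injectiveP/injectiveP => ti a b.
    by move=> e; apply: ti; rewrite !ffunE e.
  by rewrite !ffunE => /perm_inj; apply: ti.
by apply: eq_forallb => a; rewrite !ffunE permJ (inj_eq perm_inj).
Qed.

Lemma relabel_codom (L n : nat) (r : 'S_n) (t u : {ffun 'I_L -> 'I_n}) :
  map r (codom t) = codom u -> relabel r t = u.
Proof.
move=> e; apply/ffunP => a; rewrite ffunE.
have := congr1 (fun l => nth (r (t a)) l (enum_rank a)) e.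
have H (v : {ffun 'I_L -> 'I_n}) x : nth x (codom v) (enum_rank a) = v a.
  by rewrite codomE (nth_map a) ?nth_enum_rank // -cardE ltn_ord.
rewrite (nth_map (t a)) ?H //.
by rewrite size_codom ltn_ord.
Qed.

Lemma porbitJ (n : nat) (s r : 'S_n) (x : 'I_n) :
  porbit (s ^ r)%g (r x) = r @: porbit s x.
Proof.
apply/setP => y; apply/porbitP/imsetP => [[i ->]|[z /porbitP[i ->] ->]].
  by exists ((s ^+ i)%g x); rewrite ?mem_porbit // -conjXg permJ.
by exists i; rewrite -conjXg permJ.
Qed.

(** What lies off a cycle forms a pattern that only depends on the relative
    order of the labels off the cycle. *)
Lemma occ_offJ (L k n : nat) (tau : 'S_k) (s r : 'S_n)
    (t : {ffun 'I_L -> 'I_n}) :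
  {in [predC codom t] &, forall x y : 'I_n, (x < y)%N -> (r x < r y)%N} ->
  is_cycle s t ->
  occ_off tau (s ^ r)%g (relabel r t) = occ_off tau s t.
Proof.
move=> rm ct.
have rE x y : x \notin codom t -> y \notin codom t -> (r x < r y) = (x < y).
  move=> xt yt; apply/idP/idP => [|xy]; last by apply: rm.
  apply: contraLR; rewrite -!leqNgt leq_eqVlt => /orP[/eqP/val_inj->//|yx].
  by apply/ltnW/rm.
rewrite /occ_off -[RHS](card_imset (f := map_tuple r)); last first.
  by move=> i j /(congr1 val) /= /(inj_map perm_inj)/val_inj.
have mE i : meets (relabel r t) (map_tuple r i) = meets t (i : k.-tuple _).
  apply: eq_existsb => a; apply: eq_existsb => b.
  by rewrite tnth_map ffunE (inj_eq perm_inj).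
have oE i : ~~ meets t i ->
    occurrence tau (s ^ r)%g (map_tuple r i) = occurrence tau s i.
  move=> mi.
  have it b : tnth i b \notin codom t.
    apply: contra mi => /codomP[a e].
    by apply/existsP; exists a; apply/existsP; exists b; rewrite e.
  apply: eq_forallb => a; apply: eq_forallb => b; rewrite !tnth_map !permJ.
  by rewrite !rE ?is_cycle_mem.
apply: eq_card => j; rewrite inE; apply/andP/imsetP => [[oj mj]|[i]].
  have jE : j = map_tuple r (map_tuple (r^-1)%g j).
    apply: val_inj; rewrite /= -map_comp map_id_in // => x _.
    by rewrite /= permKV.
  set i := map_tuple (r^-1)%g j in jE.
  exists i => //; rewrite inE.
  by move: oj mj; rewrite jE mE => oj mj; rewrite -oE // oj.
by rewrite inE => /andP[oi mi] ->; rewrite mE oE.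
Qed.

(** * Conjugation invariance *)

Lemma sum_class_eq (n : nat) (C : {set 'S_n}) (F F' : 'S_n -> nat) (r : 'S_n) :
  (forall s r : 'S_n, s \in C -> (s ^ r)%g \in C) ->
  (forall s, s \in C -> F s = F' (s ^ r)%g) ->
  \sum_(s in C) F s = \sum_(s in C) F' s.
Proof.
move=> CJ FF; rewrite [RHS](reindex_inj (@conjg_inj _ r)) /=.
apply: eq_big => s; last exact: FF.
by apply/idP/idP => [|/CJ-/(_ r^-1)%g]; [exact: CJ | rewrite conjgK].
Qed.

Lemma touchP (L n : nat) (t u : {ffun 'I_L -> 'I_n}) :
  reflect (exists a b, u b = t a) (touch t u).
Proof.
apply: (iffP existsP) => [[a /existsP[b /eqP]]|[a [b e]]]; first by exists a, b.
by exists a; apply/existsP; exists b; apply/eqP.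
Qed.

Lemma uniq_codom_pair (L n : nat) (t u : {ffun 'I_L -> 'I_n}) :
  injectiveb t -> injectiveb u -> ~~ touch t u -> uniq (codom t ++ codom u).
Proof.
move=> ti ui ntu; rewrite cat_uniq; apply/and3P; split=> //.
apply: contra ntu => /hasP[x /codomP[b ->] /codomP[a e]].
by apply/touchP; exists a, b.
Qed.

Section Class.
Variables (n : nat) (C : {set 'S_n}).
Hypothesis CJ : forall s r : 'S_n, s \in C -> (s ^ r)%g \in C.

Lemma class_cycle_const (L : nat) (t u : {ffun 'I_L -> 'I_n}) :
  injectiveb t -> injectiveb u ->
  \sum_(s in C) is_cycle s t = \sum_(s in C) is_cycle s u.
Proof.
move=> ti ui; have [|r [rt _]] := perm_extend ti ui; first by rewrite !size_codom.
apply: (sum_class_eq (r := r) CJ) => s _.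
by rewrite -(relabel_codom rt) is_cycleJ.
Qed.

Lemma class_pair_const (L : nat) (t u t' u' : {ffun 'I_L -> 'I_n}) :
  injectiveb t -> injectiveb u -> ~~ touch t u ->
  injectiveb t' -> injectiveb u' -> ~~ touch t' u' ->
  \sum_(s in C) (is_cycle s t && is_cycle s u) =
  \sum_(s in C) (is_cycle s t' && is_cycle s u').
Proof.
move=> ti ui tu ti' ui' tu'.
have [|r [/eqP rtu _]] :=
  perm_extend (uniq_codom_pair ti ui tu) (uniq_codom_pair ti' ui' tu').
  by rewrite !size_cat !size_codom.
move: rtu; rewrite map_cat eqseq_cat ?size_map ?size_codom //.
case/andP=> /eqP rt /eqP ru.
apply: (sum_class_eq (r := r) CJ) => s _.
by rewrite -(relabel_codom rt) -(relabel_codom ru) !is_cycleJ.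
Qed.

(** Given that the labels of [t] form a cycle, the number of occurrences avoiding
    that cycle has a mean that does not depend on [t]. This is what lets the mean
    of the whole count be compared for different positions of the cycle. *)
Lemma class_off_const (L k : nat) (tau : 'S_k) (t u : {ffun 'I_L -> 'I_n}) :
  injectiveb t -> injectiveb u ->
  \sum_(s in C) is_cycle s t * occ_off tau s t =
  \sum_(s in C) is_cycle s u * occ_off tau s u.
Proof.
move=> ti ui; have [|r [rt rm]] := perm_extend ti ui; first by rewrite !size_codom.
apply: (sum_class_eq (r := r) CJ) => s _.
rewrite -(relabel_codom rt) is_cycleJ.
by case ct: (is_cycle s t) => //; rewrite occ_offJ.
Qed.

End Class.

(** * Cycles whose points lie in corners *)

Lemma card_tuple_pair (m : nat) (T : finType) (a b : 'I_m) (U : {set T * T}) :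
  a != b ->
  #|[set i : m.-tuple T | (tnth i a, tnth i b) \in U]| <= #|U| * #|T| ^ (m - 2).
Proof.
move=> ab; apply: leq_trans (card_ffun_pair U ab).
pose h (i : m.-tuple T) := [ffun c => tnth i c].
rewrite -(card_imset (f := h)); last first.
  move=> i j /ffunP e; apply: eq_from_tnth => c.
  by have := e c; rewrite !ffunE.
apply/subset_leq_card/subsetP => f /imsetP[i]; rewrite inE => iU ->.
by rewrite inE !ffunE.
Qed.

(** If every occurrence using a point of the cycle also uses another point with
    an extreme coordinate, then, besides one point of the cycle, a second point of
    the occurrence has only [2 * #|E|] choices instead of [n]. *)
Lemma occ_at_le (L k n : nat) (tau : 'S_k.+2) (s : 'S_n)
    (t : {ffun 'I_L -> 'I_n}) (E : {set 'I_n}) :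
  (forall a b (i : k.+2.-tuple 'I_n), occurrence tau s i -> tnth i b = t a ->
     exists2 b', b' != b & (tnth i b' \in E) || (s (tnth i b') \in E)) ->
  occ_at tau s t <= L * k.+2 ^ 2 * (2 * #|E| * n ^ k).
Proof.
move=> H; pose E2 := E :|: s @^-1: E.
have cE2 : #|E2| <= 2 * #|E|.
  apply: (leq_trans (leq_card_setU _ _)).
  rewrite mul2n -addnn leq_add2l.
  by rewrite on_card_preimset //; exists (s^-1)%g => x _; rewrite ?permK ?permKV.
pose U (a : 'I_L) := [set xy : 'I_n * 'I_n | (xy.1 == t a) && (xy.2 \in E2)].
have cU a : #|U a| <= 2 * #|E|.
  apply: leq_trans cE2; rewrite -(card_in_imset (f := snd)).
    apply/subset_leq_card/subsetP => y /imsetP[[x z]].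
    by rewrite inE => /andP[_ ?] ->.
  move=> [x y] [x' y']; rewrite !inE /= => /andP[/eqP-> _] /andP[/eqP-> _].
  by move=> ->.
pose B (q : 'I_L * ('I_k.+2 * 'I_k.+2)) :=
  [set i : k.+2.-tuple 'I_n | (tnth i q.2.1, tnth i q.2.2) \in U q.1].
pose Q := [pred q : 'I_L * ('I_k.+2 * 'I_k.+2) | q.2.1 != q.2.2].
have sub : [set i : k.+2.-tuple 'I_n | occurrence tau s i && meets t i]
    \subset \bigcup_(q | Q q) B q.
  apply/subsetP => i; rewrite inE => /andP[oi /existsP[a /existsP[b /eqP e]]].
  have [b' b'b Eb'] := H a b i oi e.
  apply/bigcupP; exists (a, (b, b')); first by rewrite inE /= eq_sym.
  by rewrite !inE /= e eqxx.
apply: (leq_trans (subset_leq_card sub)).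
apply: (@leq_trans (#|Q| * (2 * #|E| * n ^ k))).
  apply: leq_card_bigcup => -[a [b b']] /= bb'.
  apply: (leq_trans (card_tuple_pair (U a) bb')).
  by rewrite card_ord !subSS subn0 leq_mul2r cU orbT.
rewrite leq_mul2r; apply/orP; right.
apply: (leq_trans (max_card _)); rewrite !card_prod !card_ord.
by rewrite expnS expn1.
Qed.

(** All points of such a cycle lie near the corner (0, 0) of the square when the
    pattern does not start with its least value; otherwise, when the length is
    even, they alternate between the corners (0, n) and (n, 0). *)
Definition in_corner (L k n e : nat) (tau : 'S_k.+2)
    (t : {ffun 'I_L -> 'I_n}) : bool :=
  [forall a : 'I_L, if (tau ord0 != ord0) || ~~ odd a then t a < e
                    else n <= t a + e].

Definition extreme (n e : nat) : {set 'I_n} :=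
  [set x : 'I_n | (x < e) || (n <= x + e)].

Lemma card_extreme (n e : nat) : #|extreme n e| <= 2 * e.
Proof.
have h1 : #|[set x : 'I_n | x < e]| <= e.
  rewrite cardE -(size_map val) -[leqRHS](size_iota 0); apply: uniq_leq_size.
    by rewrite (map_inj_uniq val_inj) enum_uniq.
  by move=> y /mapP[x]; rewrite mem_enum inE mem_iota => xe ->.
have h2 : #|[set x : 'I_n | n <= x + e]| <= e.
  apply: leq_trans h1; rewrite -(card_imset _ (@rev_ord_inj n)).
  apply/subset_leq_card/subsetP => x /imsetP[y]; rewrite !inE => ye -> /=.
  by have := ltn_ord y; lia.
have -> : extreme n e = [set x : 'I_n | x < e] :|: [set x : 'I_n | n <= x + e].
  by apply/setP => x; rewrite !inE.
by apply: (leq_trans (leq_card_setU _ _)); rewrite mul2n -addnn leq_add.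
Qed.

Lemma occurrence_pos (k n : nat) (tau : 'S_k) (s : 'S_n) (i : k.-tuple 'I_n)
    (a b : 'I_k) :
  occurrence tau s i -> a < b -> tnth i a < tnth i b.
Proof. by move=> /forallP/(_ a)/forallP/(_ b)/implyP o /o/andP[]. Qed.

Lemma occurrence_val (k n : nat) (tau : 'S_k) (s : 'S_n) (i : k.-tuple 'I_n)
    (a b : 'I_k) :
  occurrence tau s i -> tau a < tau b -> s (tnth i a) < s (tnth i b).
Proof.
move=> /forallP/(_ (tau a))/forallP/(_ (tau b))/implyP o /o/andP[_].
by rewrite !permK.
Qed.

(** A point of an occurrence near the corner (0, 0) has an extreme point of the
    occurrence to its left or below it, unless it is the first and least entry;
    similarly for the corners (0, n) and (n, 0), where the exceptions are a first
    and greatest entry and a last and least entry. A pattern of size at least two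
    that starts with its least value has no entry of the last two kinds. *)
Lemma corner_second_point (L k n e : nat) (tau : 'S_k.+2) (s : 'S_n)
    (t : {ffun 'I_L.+1 -> 'I_n}) (a : 'I_L.+1) (b : 'I_k.+2)
    (i : k.+2.-tuple 'I_n) :
  odd L -> is_cycle s t -> in_corner e tau t -> occurrence tau s i ->
  tnth i b = t a ->
  exists2 b', b' != b &
    (tnth i b' \in extreme n e) || (s (tnth i b') \in extreme n e).
Proof.
move=> oL ct /forallP cor oi ib.
have sx : s (tnth i b) = t (ordS a).
  by rewrite ib; case/andP: ct => _ /forallP/(_ a)/eqP.
have oS : odd (ordS a) = ~~ odd a by rewrite /= odd_mod //= oL.
have := cor a; have := cor (ordS a); rewrite oS negbK -sx -ib.
have lt0 (j : 'I_k.+2) : j != ord0 -> 0 < j by rewrite -val_eqE /= lt0n.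
have ltm (j : 'I_k.+2) : j != ord_max -> j < k.+1.
  rewrite -val_eqE /= => jm; have := ltn_ord j.
  by rewrite ltnS leq_eqVlt (negPf jm).
have low_pos : tnth i b < e -> b != ord0 ->
    exists2 b', b' != b &
      (tnth i b' \in extreme n e) || (s (tnth i b') \in extreme n e).
  move=> be b0; exists ord0; first by rewrite eq_sym.
  rewrite inE; apply/orP; left; apply/orP; left; apply: leq_trans be.
  by apply: ltnW; rewrite ltnS; apply: (occurrence_pos oi); apply: lt0.
have low_val b' : s (tnth i b) < e -> tau b' < tau b ->
    exists2 b', b' != b &
      (tnth i b' \in extreme n e) || (s (tnth i b') \in extreme n e).
  move=> be bb'; exists b'; first by apply: contraTneq bb' => ->; rewrite ltnn.
  rewrite !inE; apply/orP; right; apply/orP; left; apply: leq_trans be.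
  by apply: ltnW; rewrite ltnS; apply: (occurrence_val oi).
(* the point is near (0, 0) *)
case: (eqVneq (tau ord0) ord0) => [t0|t0] /=; last first.
  move=> se be; have [b0|/(low_pos be)//] := eqVneq b ord0.
  apply: (low_val ((tau^-1)%g ord0) se); rewrite permKV b0 lt0 //.
(* the point is near (n, 0) for odd [a] and near (0, n) for even [a] *)
case oa: (odd a); move=> /= se be.
  have [bm|bm] := eqVneq b ord_max.
    apply: (low_val ord0 se); rewrite t0 bm lt0 // -t0 (inj_eq perm_inj) //.
  exists ord_max; first by rewrite eq_sym.
  rewrite inE; apply/orP; left; apply/orP; right.
  apply: (leq_trans be); rewrite leq_add2r ltnW //.
  by apply: (occurrence_pos oi); apply: ltm.
have [b0|/(low_pos be)//] := eqVneq b ord0.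
exists ord_max; first by rewrite b0.
rewrite !inE; apply/orP; right; apply/orP; right.
apply: (leq_trans se); rewrite leq_add2r ltnW //.
by apply: (occurrence_val oi); rewrite b0 t0 lt0 // -t0 (inj_eq perm_inj).
Qed.

Lemma occ_at_corner (L k n e : nat) (tau : 'S_k.+2) (s : 'S_n)
    (t : {ffun 'I_L.+1 -> 'I_n}) :
  odd L -> is_cycle s t -> in_corner e tau t ->
  occ_at tau s t <= L.+1 * k.+2 ^ 2 * (4 * e * n ^ k).
Proof.
move=> oL ct cor.
have := @occ_at_le _ _ _ tau s t (extreme n e).
have H a b i := @corner_second_point L k n e tau s t a b i oL ct cor.
move/(_ H)/leq_trans; apply; rewrite leq_mul2l leq_mul2r.
have -> : 2 * #|extreme n e| <= 4 * e.
  by rewrite (_ : 4 = 2 * 2) // -mulnA leq_mul2l card_extreme.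
by rewrite !orbT.
Qed.

(** * Many occurrences use a cycle of a given length *)

Definition cycle_labels (L n : nat) (s : 'S_n) : {set 'I_n} :=
  [set x | #|porbit s x| == L].

Lemma mem_cycle_labelsJ (L n : nat) (s r : 'S_n) (x : 'I_n) :
  (r x \in cycle_labels L (s ^ r)%g) = (x \in cycle_labels L s).
Proof. by rewrite !inE porbitJ card_imset //; apply: perm_inj. Qed.

Lemma porbit_is_cycle (L n : nat) (s : 'S_n) (x : 'I_n) :
  x \in cycle_labels L.+1 s ->
  is_cycle s [ffun a : 'I_L.+1 => iter a s x].
Proof.
rewrite inE => /eqP cx; apply/andP; split.
  apply/injectiveP => a b; rewrite !ffunE => e; apply/val_inj/eqP => /=.
  have := uniq_traject_porbit s x; rewrite cx => u.
  rewrite -(nth_uniq x _ _ u) ?size_traject ?ltn_ord //.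
  by rewrite !nth_traject ?ltn_ord // e.
apply/forallP => a; rewrite !ffunE -iterS; apply/eqP; rewrite [ordS a : nat]/=.
have := ltn_ord a; rewrite ltnS leq_eqVlt => /orP[/eqP->|aL].
  by rewrite modnn -[in LHS]cx; apply: iter_porbit.
by rewrite modn_small.
Qed.

Lemma sum_occ_at_ge (L k n : nat) (tau : 'S_k.+1) (s : 'S_n) :
  #|[set i : k.+1.-tuple 'I_n | occurrence tau s i &&
      (tnth i ord0 \in cycle_labels L.+1 s)]| <=
  \sum_(t : {ffun 'I_L.+1 -> 'I_n}) is_cycle s t * occ_at tau s t.
Proof.
pose B (t : {ffun 'I_L.+1 -> 'I_n}) :=
  [set i : k.+1.-tuple 'I_n | occurrence tau s i && meets t i].
apply: (@leq_trans #|\bigcup_(t : {ffun 'I_L.+1 -> 'I_n} | is_cycle s t) B t|).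
  apply/subset_leq_card/subsetP => i; rewrite inE => /andP[oi i0].
  apply/bigcupP; exists [ffun a : 'I_L.+1 => iter a s (tnth i ord0)].
    exact: porbit_is_cycle.
  rewrite inE oi; apply/existsP; exists ord0; apply/existsP; exists ord0.
  by rewrite ffunE.
apply: (leq_trans (leq_card_bigcup_sum _ _)).
by rewrite big_mkcond; apply: leq_sum => t _; case: ifP; rewrite ?mul1n.
Qed.

(** [z] lists [k] positions and then [k] values in increasing order of the
    pattern, so that for increasing [z] the prescribed points form an
    occurrence. *)
Definition prescribes (L k n : nat) (tau : 'S_k) (s : 'S_n)
    (z : {ffun 'I_(k + k) -> 'I_n}) : bool :=
  [forall a : 'I_k, (z (lshift k a) \in cycle_labels L s) &&
                    (s (z (lshift k a)) == z (rshift k (tau a)))].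

Lemma prescribesJ (L k n : nat) (tau : 'S_k) (s r : 'S_n)
    (z : {ffun 'I_(k + k) -> 'I_n}) :
  prescribes L tau (s ^ r)%g (relabel r z) = prescribes L tau s z.
Proof.
apply: eq_forallb => a; rewrite !ffunE mem_cycle_labelsJ permJ.
by rewrite (inj_eq perm_inj).
Qed.

Lemma class_prescribes_const (n L k : nat) (C : {set 'S_n}) (tau : 'S_k)
    (z w : {ffun 'I_(k + k) -> 'I_n}) :
  (forall s r : 'S_n, s \in C -> (s ^ r)%g \in C) ->
  injectiveb z -> injectiveb w ->
  \sum_(s in C) prescribes L tau s z = \sum_(s in C) prescribes L tau s w.
Proof.
move=> CJ zi wi; have [|r [rz _]] := perm_extend zi wi.
  by rewrite !size_codom.
apply: (sum_class_eq (r := r) CJ) => s _.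
by rewrite -(relabel_codom rz) prescribesJ.
Qed.

Definition increasing (m n : nat) (z : {ffun 'I_m -> 'I_n}) : bool :=
  [forall a : 'I_m, forall b : 'I_m, (a < b) ==> (z a < z b)].

Lemma increasingP (m n : nat) (z : {ffun 'I_m -> 'I_n}) (a b : 'I_m) :
  increasing z -> a < b -> z a < z b.
Proof. by move=> /forallP/(_ a)/forallP/(_ b)/implyP. Qed.

Lemma increasing_injective (m n : nat) (z : {ffun 'I_m -> 'I_n}) :
  increasing z -> injectiveb z.
Proof.
move=> zi; apply/injectiveP => a b e; apply/val_inj/eqP; rewrite eqn_leq.
by apply/andP; split; rewrite leqNgt; apply/negP => /(increasingP zi);
  rewrite e ltnn.
Qed.

Lemma card_increasing_ge (m n : nat) :
  'C(n, m) <= #|[set z : {ffun 'I_m -> 'I_n} | increasing z]|.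
Proof.
rewrite -card_ltn_sorted_tuples.
pose h (i : m.-tuple 'I_n) := [ffun c => tnth i c].
rewrite -(card_imset (f := h)); last first.
  move=> i j /ffunP e; apply: eq_from_tnth => c.
  by have := e c; rewrite !ffunE.
apply/subset_leq_card/subsetP => f /imsetP[i]; rewrite !inE => si ->.
apply/forallP => a; apply/forallP => b; apply/implyP => ab; rewrite !ffunE.
have x0 : 'I_n := tnth i a.
have := @sorted_ltn_nth _ ltn ltn_trans 0 _ si a b.
rewrite !inE size_map size_tuple !ltn_ord => /(_ isT isT ab).
by rewrite !(nth_map (tnth i a)) ?size_tuple ?ltn_ord // -!tnth_nth.
Qed.

Lemma sum_prescribes_le (L k n : nat) (tau : 'S_k.+1) (s : 'S_n) :
  \sum_(z : {ffun 'I_(k.+1 + k.+1) -> 'I_n} | increasing z)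
     prescribes L tau s z <=
  #|[set i : k.+1.-tuple 'I_n | occurrence tau s i &&
      (tnth i ord0 \in cycle_labels L s)]|.
Proof.
pose Z := [set z : {ffun 'I_(k.+1 + k.+1) -> 'I_n} |
            increasing z && prescribes L tau s z].
have -> : \sum_(z : {ffun 'I_(k.+1 + k.+1) -> 'I_n} | increasing z)
     prescribes L tau s z = #|Z|.
  rewrite -sum1dep_card big_mkcondr /=.
  by apply: eq_bigr => z _; case: prescribes.
pose h (z : {ffun 'I_(k.+1 + k.+1) -> 'I_n}) :=
  [tuple z (lshift k.+1 a) | a < k.+1].
rewrite -(card_in_imset (f := h)); last first.
  move=> z w; rewrite !inE => /andP[_ /forallP pz] /andP[_ /forallP pw] e.
  have el a : z (lshift k.+1 a) = w (lshift k.+1 a).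
    by have := congr1 (fun i => tnth i a) e; rewrite !tnth_mktuple.
  apply/ffunP => c; rewrite -(splitK c); case: (split c) => a /=; first exact: el.
  rewrite -(permKV tau a); have /andP[_ /eqP<-] := pz ((tau^-1)%g a).
  by rewrite el; have /andP[_ /eqP->] := pw ((tau^-1)%g a).
apply/subset_leq_card/subsetP => i /imsetP[z]; rewrite !inE.
move=> /andP[iz /forallP pz] ->; rewrite tnth_mktuple.
have /andP[] := pz ord0; rewrite inE => -> _; rewrite andbT.
apply/forallP => a; apply/forallP => b; apply/implyP => ab.
rewrite !tnth_mktuple (increasingP iz) //=.
have /andP[_ /eqP->] := pz ((tau^-1)%g a).
have /andP[_ /eqP->] := pz ((tau^-1)%g b).
by rewrite !permKV (increasingP iz) //= ltn_add2l.
Qed.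

(** Every choice of [k] labels lying in cycles of length [L] gives an injective
    [z], unless two of these labels coincide or one is the image of another. *)
Lemma sum_injective_prescribes_ge (L k n : nat) (tau : 'S_k) (s : 'S_n) :
  1 < L ->
  #|cycle_labels L s| ^ k - 2 * k ^ 2 * n ^ (k - 1) <=
  \sum_(z : {ffun 'I_(k + k) -> 'I_n} | injectiveb z) prescribes L tau s z.
Proof.
move=> L1; set P := cycle_labels L s.
pose Z := [set z : {ffun 'I_(k + k) -> 'I_n} |
            injectiveb z && prescribes L tau s z].
have -> : \sum_(z : {ffun 'I_(k + k) -> 'I_n} | injectiveb z)
     prescribes L tau s z = #|Z|.
  rewrite -sum1dep_card big_mkcondr /=.
  by apply: eq_bigr => z _; case: prescribes.
pose X := [set x : {ffun 'I_k -> 'I_n} | [forall c, x c \in P]].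
have cX : #|X| = #|P| ^ k.
  by rewrite (card_family_prod (fun=> P)) prod_nat_const card_ord.
pose B1 := [set x : {ffun 'I_k -> 'I_n} | ~~ injectiveb x].
pose B (q : 'I_k * 'I_k) :=
  [set x : {ffun 'I_k -> 'I_n} | (x q.1, x q.2) \in [set (s y, y) | y : 'I_n]].
pose Q := [pred q : 'I_k * 'I_k | q.1 != q.2].
pose B2 := \bigcup_(q | Q q) B q.
have cB1 : #|B1| <= k ^ 2 * n ^ (k - 1).
  by apply: (leq_trans (card_not_injective _ _)); rewrite card_ord.
have cB2 : #|B2| <= k ^ 2 * n ^ (k - 1).
  apply: (@leq_trans (#|Q| * n ^ (k - 1))); last first.
    rewrite leq_mul2r; apply/orP; right; apply: (leq_trans (max_card _)).
    by rewrite card_prod card_ord mulnn.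
  apply: leq_card_bigcup => -[a b] /= ab.
  apply: (leq_trans (card_ffun_pair _ ab)).
  rewrite card_imset; last by move=> x y [].
  have := ltn_ord a; have := ltn_ord b; move: ab; rewrite -val_eqE /=.
  move=> ab' bm am; have -> : k - 1 = (k - 2).+1 by lia.
  by rewrite expnS !card_ord.
pose h (x : {ffun 'I_k -> 'I_n}) : {ffun 'I_(k + k) -> 'I_n} :=
  [ffun c => match split c with
             | inl a => x a
             | inr a => s (x ((tau^-1)%g a)) end].
have hl x a : h x (lshift k a) = x a.
  by rewrite ffunE -[lshift k a]/(unsplit (inl a)) unsplitK.
have hr x a : h x (rshift k a) = s (x ((tau^-1)%g a)).
  by rewrite ffunE -[rshift k a]/(unsplit (inr a)) unsplitK.
apply: (@leq_trans #|X :\: (B1 :|: B2)|).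
  rewrite cardsD cX; apply: leq_sub2l.
  apply: (leq_trans (subset_leq_card (subsetIr _ _))).
  apply: (leq_trans (leq_card_setU _ _)).
  by rewrite -mulnA mul2n -addnn leq_add.
rewrite -(card_in_imset (f := h)); last first.
  by move=> x y _ _ e; apply/ffunP => a; rewrite -!hl e.
apply/subset_leq_card/subsetP => z /imsetP[x].
rewrite !inE negb_or negbK => /andP[/andP[/injectiveP xi xB2] /forallP xP] ->.
have xs a b : x a != s (x b).
  apply/eqP => e; have [ab|ab] := eqVneq a b.
    have := xP b; rewrite inE => /eqP cL.
    have := uniq_traject_porbit s (x b); rewrite cL -(subnKC L1) /=.
    by rewrite inE -e ab eqxx.
  case/negP: xB2; apply/bigcupP; exists (a, b) => //.
  by rewrite inE /= e; apply/imsetP; exists (x b).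
apply/andP; split.
  apply/injectiveP => c d; rewrite -(splitK c) -(splitK d).
  case: (split c) => a; case: (split d) => b; rewrite /= ?hl ?hr.
  - by move/xi ->.
  - by move/eqP; rewrite (negPf (xs _ _)).
  - by move/esym/eqP; rewrite (negPf (xs _ _)).
  - by move/perm_inj/xi/perm_inj ->.
by apply/forallP => a; rewrite hl hr permK xP eqxx.
Qed.

(** By conjugation invariance each injective [z] is prescribed equally often, and
    one out of [(k.+1 + k.+1)`!] injective [z] is increasing. *)
Lemma class_sum_occ_at_ge (L k n p : nat) (C : {set 'S_n}) (tau : 'S_k.+1) :
  0 < L ->
  (forall s r : 'S_n, s \in C -> (s ^ r)%g \in C) ->
  (forall s, s \in C -> p <= #|cycle_labels L.+1 s|) ->
  #|C| * (p ^ k.+1 - 2 * k.+1 ^ 2 * n ^ k) <=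
  (k.+1 + k.+1)`! *
  \sum_(s in C) \sum_(t : {ffun 'I_L.+1 -> 'I_n}) is_cycle s t * occ_at tau s t.
Proof.
move=> L0 CJ Cp; set m := k.+1 + k.+1.
pose J := prescribes L.+1 tau (n := n).
have h1 : #|C| * (p ^ k.+1 - 2 * k.+1 ^ 2 * n ^ k) <=
    \sum_(s in C) \sum_(z : {ffun 'I_m -> 'I_n} | injectiveb z) J s z.
  rewrite -sum_nat_const; apply: leq_sum => s sC.
  apply: leq_trans (sum_injective_prescribes_ge tau s _) => //.
  by rewrite subn1 /=; apply: leq_sub2r; rewrite leq_exp2r // Cp.
have h2 : \sum_(s in C) \sum_(z : {ffun 'I_m -> 'I_n} | increasing z) J s z <=
  \sum_(s in C) \sum_(t : {ffun 'I_L.+1 -> 'I_n}) is_cycle s t * occ_at tau s t.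
  apply: leq_sum => s _.
  by apply: leq_trans (sum_occ_at_ge L tau s); apply: sum_prescribes_le.
apply: (leq_trans h1); apply: leq_trans (leq_mul (leqnn _) h2).
rewrite exchange_big [X in _ <= _ * X]exchange_big /=.
have [z0 z0i|no] := pickP (fun z : {ffun 'I_m -> 'I_n} => injectiveb z); last first.
  by rewrite big_pred0.
rewrite (eq_bigr (fun=> \sum_(s in C) J s z0)); last first.
  by move=> z zi; apply: class_prescribes_const.
rewrite [X in _ <= _ * X](eq_bigr (fun=> \sum_(s in C) J s z0)); last first.
  by move=> z /increasing_injective zi; apply: class_prescribes_const.
rewrite !sum_nat_const mulnA leq_mul2r; apply/orP; right.
have := card_inj_ffuns 'I_m 'I_n; rewrite cardsE !card_ord => ->.
by rewrite -bin_ffact mulnC leq_mul2l -cardsE card_increasing_ge orbT.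
Qed.

(** * Cycle types *)

Lemma sum_porbits (n : nat) (s : 'S_n) (F : {set 'I_n} -> nat) :
  \sum_(x : 'I_n) F (porbit s x) = \sum_(c in porbits s) #|c| * F c.
Proof.
rewrite (partition_big_imset (porbit s)) /=.
apply: eq_bigr => c /imsetP[y _ ->].
rewrite (eq_bigr (fun=> F (porbit s y))) => [|x /eqP-> //].
rewrite sum_nat_const; congr (_ * _); apply: eq_card => x.
by rewrite -eq_porbit_mem.
Qed.

Lemma count_porbits (n : nat) (s : 'S_n) (d : nat) :
  count_mem d [seq #|(c : {set 'I_n})| | c <- enum (porbits s)] * d =
  #|cycle_labels d s|.
Proof.
have -> : #|cycle_labels d s| = \sum_(x : 'I_n) (#|porbit s x| == d).
  rewrite -sum1_card big_mkcond; apply: eq_bigr => x _.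
  by rewrite inE; case: eqP.
rewrite (sum_porbits s (fun c => #|c| == d)) count_map -big_enum /=.
elim: (enum _) => [|c l IH]; first by rewrite big_nil.
rewrite big_cons /= -IH mulnDl; congr (_ + _).
by case: eqP => [->|_]; rewrite ?mul1n ?muln1 ?mul0n ?muln0.
Qed.

Lemma zero_notin_porbits (n : nat) (s : 'S_n) :
  0 \notin [seq #|(c : {set 'I_n})| | c <- enum (porbits s)].
Proof.
apply/mapP => -[c]; rewrite mem_enum => /imsetP[x _ ->] /esym/eqP.
by rewrite (negPf (card_porbit_neq0 s x)).
Qed.

Lemma cycle_classP (n : nat) (lam : intpart n) (s : 'S_n) :
  reflect (forall d, mult d lam * d = #|cycle_labels d s|)
          (s \in cycle_class lam).
Proof.
rewrite inE; apply: (iffP idP) => [/seq.permP e d|e].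
  by rewrite -count_porbits /mult e.
apply/allP => d; rewrite mem_cat => dl; apply/eqP.
have d0 : 0 < d.
  rewrite lt0n; apply: contraTneq dl => ->; rewrite (negPf (zero_notin_porbits s)).
  by rewrite orbF; case: lam {e} => l /= /and3P[].
by apply/eqP; rewrite -(eqn_pmul2r d0) count_porbits -e.
Qed.

Lemma card_cycle_labelsJ (n d : nat) (s r : 'S_n) :
  #|cycle_labels d (s ^ r)%g| = #|cycle_labels d s|.
Proof.
rewrite -[RHS](card_imset _ (@perm_inj _ r)); apply: eq_card => x.
rewrite -{1}(permKV r x) mem_cycle_labelsJ; apply/idP/imsetP => [h|[y h ->]].
  by exists ((r^-1)%g x); rewrite ?permKV.
by rewrite permK.
Qed.

Lemma cycle_classJ (n : nat) (lam : intpart n) (s r : 'S_n) :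
  s \in cycle_class lam -> (s ^ r)%g \in cycle_class lam.
Proof.
by move=> /cycle_classP e; apply/cycle_classP => d; rewrite e card_cycle_labelsJ.
Qed.

Lemma cycle_type_exists (n : nat) (s : 'S_n) :
  exists lam : intpart n, s \in cycle_class lam.
Proof.
pose l := [seq #|(c : {set 'I_n})| | c <- enum (porbits s)].
have Hl : [&& sorted geq (sort geq l), 0 \notin sort geq l
            & sumn (sort geq l) == n].
  apply/and3P; split.
  - by apply: sort_sorted => a b; apply: leq_total.
  - by rewrite mem_sort zero_notin_porbits.
  - rewrite (perm_sumn (permEl (perm_sort geq l))) sumnE big_map big_enum /=.
    apply/eqP; transitivity (\sum_(x : 'I_n) 1); last by rewrite sum1_card card_ord.
    rewrite (sum_porbits s (fun=> 1)); apply: eq_bigr => c _; exact/esym/muln1.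
by exists (IntPart Hl); rewrite inE /= perm_sort.
Qed.

Lemma card_porbit_eq (n d : nat) (s : 'S_n) (x : 'I_n) :
  0 < d -> iter d s x = x ->
  (forall j, 0 < j < d -> iter j s x <> x) -> #|porbit s x| = d.
Proof.
move=> d0 dx small; have p0 : 0 < #|porbit s x| by rewrite lt0n card_porbit_neq0.
case: (ltngtP #|porbit s x| d) => // h.
  by case: (small #|porbit s x|); rewrite ?p0 ?h ?iter_porbit.
have := @nth_uniq _ x (traject s x #|porbit s x|) 0 d.
rewrite size_traject => /(_ p0 h (uniq_traject_porbit s x)).
by rewrite !nth_traject // dx eqxx => /esym/eqP d00; rewrite -d00 in d0.
Qed.

(** The labels below [4 * u] are rotated in blocks of four, the next [2 * v]
    are swapped in pairs, the others are fixed. *)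
Definition block_step (u v i : nat) : nat :=
  if i < 4 * u then if i %% 4 == 3 then i - 3 else i.+1
  else if i < 4 * u + 2 * v then if odd i then i.-1 else i.+1
  else i.

Lemma block_step_rotate (u v a b : nat) :
  a < u -> b < 4 -> block_step u v (4 * a + b) = 4 * a + b.+1 %% 4.
Proof.
move=> au; case: b => [|[|[|[|b]]]] // _; rewrite /block_step;
  by case: ifP => h; [case: ifP; lia|lia].
Qed.

Lemma block_step_swap (u v i : nat) :
  4 * u <= i < 4 * u + 2 * v ->
  block_step u v i = if odd i then i.-1 else i.+1.
Proof. by case/andP=> h1 h2; rewrite /block_step ltnNge h1 /= h2. Qed.

Lemma iter_block_step (u v i j : nat) :
  i < 4 * u -> iter j (block_step u v) i = 4 * (i %/ 4) + (i + j) %% 4.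
Proof.
move=> iu; elim: j => [|j IH].
  by rewrite /= addn0; have := divn_eq i 4; lia.
by rewrite iterS IH block_step_rotate ?ltn_mod //; lia.
Qed.

Definition block_period (u v i : nat) : nat :=
  if i < 4 * u then 4 else if i < 4 * u + 2 * v then 2 else 1.

Lemma block_periodP (u v i : nat) :
  iter (block_period u v i) (block_step u v) i = i /\
  (forall j, 0 < j < block_period u v i -> iter j (block_step u v) i <> i).
Proof.
rewrite /block_period; case: ifP => h1.
  split=> [|j]; rewrite iter_block_step //; first by have := divn_eq i 4; lia.
  by have := divn_eq i 4; lia.
case: ifP => h2.
  have hi : 4 * u <= i < 4 * u + 2 * v by rewrite h2 andbT leqNgt h1.
  split=> [|[|[|j]]] //=; rewrite (block_step_swap hi); last by case: ifP; lia.
  by case: ifP => oi; (rewrite block_step_swap; [case: ifP; lia|lia]).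
split=> [|[|j]] //=.
by rewrite /block_step h1 h2.
Qed.

Lemma block_step_lt (u v n i : nat) :
  4 * u + 2 * v <= n -> i < n -> block_step u v i < n.
Proof.
move=> un iN; rewrite /block_step; case: ifP => [h|h1].
  by case: ifP => h3; have := divn_eq i 4; lia.
by case: ifP => // h2; case: ifP => h3; lia.
Qed.

Lemma block_perm_exists (u v n : nat) :
  4 * u + 2 * v <= n ->
  exists s : 'S_n, [/\ #|cycle_labels 4 s| = 4 * u,
    #|cycle_labels 2 s| = 2 * v & #|cycle_labels 1 s| = n - (4 * u + 2 * v)].
Proof.
move=> un; pose f (i : 'I_n) := Ordinal (block_step_lt un (ltn_ord i)).
have fE j i : iter j f i = iter j (block_step u v) i :> nat.
  by elim: j => //= j ->.
have fi : injective f.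
  have f4 i : iter 4 f i = i.
    apply: ord_inj; rewrite fE; have [] := block_periodP u v i.
    rewrite /block_period; case: ifP => // _; case: ifP => _ e _ //.
      by rewrite (iterD 2 2) !e.
    by rewrite /= in e; rewrite /= !e.
  by move=> x y e; rewrite -(f4 x) -(f4 y) !iterSr e.
pose s := perm fi; exists s.
have sE j i : iter j s i = iter j f i.
  by elim: j => //= j ->; rewrite permE.
have pE i : #|porbit s i| = block_period u v i.
  have [e1 e2] := block_periodP u v i.
  apply: card_porbit_eq.
  - by rewrite /block_period; case: ifP => // _; case: ifP.
  - by apply: ord_inj; rewrite sE fE.
  - by move=> j /e2 je; rewrite sE => /(congr1 (@nat_of_ord n)); rewrite fE.
pose A := [set x : 'I_n | x < 4 * u].
pose B := [set x : 'I_n | x < 4 * u + 2 * v].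
have cA : #|A| = 4 * u by rewrite card_ord_lt //; lia.
have cB : #|B| = 4 * u + 2 * v by rewrite card_ord_lt.
have AB : A \subset B by apply/subsetP => x; rewrite !inE; lia.
split.
- rewrite -cA; apply: eq_card => x; rewrite !inE pE /block_period.
  by case: ifP => //; case: ifP.
- have -> : 2 * v = #|B :\: A| by rewrite cardsD (setIidPr AB) cA cB addKn.
  apply: eq_card => x; rewrite !inE pE /block_period.
  by case: ifP => //; case: ifP.
- have -> : n - (4 * u + 2 * v) = #|~: B|.
    by have := cardsC B; rewrite card_ord cB; lia.
  apply: eq_card => x; rewrite !inE pE /block_period.
  by case: ifP => [h|_]; [lia|case: ifP].
Qed.

(** * The test statistic *)

Lemma leq_double_divn (n q : nat) :
  0 < q -> 2 * q <= n -> n <= 2 * q * (n %/ q).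
Proof.
move=> q0 qn; have := divn_eq n q; have := ltn_pmod n q0.
move: (n %/ q) (n %% q) => a b bq e; rewrite e; nia.
Qed.

Lemma leq_add5 (a b c d e n : nat) :
  a + b + c + d + e <= n -> [/\ a <= n, b <= n, c <= n, d <= n & e <= n].
Proof. by move=> h; split; lia. Qed.

Lemma leq_double_sub (a b c : nat) : a <= b -> 2 * c <= a -> a <= 2 * (b - c).
Proof. lia. Qed.

Lemma leq_double_add (a b c d : nat) :
  a <= b -> b <= c + d -> 2 * d <= a -> a <= 2 * c.
Proof. lia. Qed.

Lemma leq_expn_double_divn (n q m : nat) :
  0 < q -> 2 * q <= n -> n ^ m <= (2 * q) ^ m * (n %/ q) ^ m.
Proof.
move=> q0 qn; rewrite -expnMn; case: m => // m.
by rewrite leq_exp2r // leq_double_divn.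
Qed.

Lemma card_touch_le (L n : nat) (t : {ffun 'I_L -> 'I_n}) :
  #|[set u : {ffun 'I_L -> 'I_n} | injectiveb u && touch t u]| <=
  L ^ 2 * n ^ (L - 1).
Proof.
pose B (q : 'I_L * 'I_L) := [set u : {ffun 'I_L -> 'I_n} | u q.2 == t q.1].
apply: (@leq_trans #|\bigcup_(q | predT q) B q|).
  apply/subset_leq_card/subsetP => u; rewrite inE => /andP[_ /touchP[a [b e]]].
  by apply/bigcupP; exists (a, b); rewrite // inE e.
apply: (@leq_trans (#|[pred q : 'I_L * 'I_L | true]| * n ^ (L - 1))).
  by apply: leq_card_bigcup => q _; rewrite card_ffun_at card_ord.
by rewrite leq_mul2r (leq_trans (max_card _)) ?orbT // card_prod card_ord mulnn.
Qed.

Definition injections (L n : nat) : {set {ffun 'I_L -> 'I_n}} :=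
  [set t : {ffun 'I_L -> 'I_n} | injectiveb t].

Lemma card_injections_le (L n : nat) : #|injections L n| <= n ^ L.
Proof.
by apply: (leq_trans (max_card _)); rewrite card_ffun !card_ord.
Qed.

Lemma card_injections_ge (L n : nat) :
  n ^ L <= #|injections L n| + L ^ 2 * n ^ (L - 1).
Proof.
have := card_not_injective L 'I_n; rewrite card_ord => h.
apply: leq_trans (leq_add (leqnn _) h).
have <- : ~: injections L n = [set f : {ffun 'I_L -> 'I_n} | ~~ injectiveb f].
  by apply/setP => f; rewrite !inE.
by rewrite cardsC card_ffun !card_ord.
Qed.

Definition corner_cycles (L k n e : nat) (tau : 'S_k.+2) :
    {set {ffun 'I_L -> 'I_n}} :=
  [set t in injections L n | in_corner e tau t].

Lemma card_corner_cycles_ge (L k n e : nat) (tau : 'S_k.+2) :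
  e <= n ->
  e ^ L <= #|corner_cycles L n e tau| + L ^ 2 * n ^ (L - 1).
Proof.
move=> en.
have low := card_ord_lt en.
have high : #|[set x : 'I_n | n <= x + e]| = e.
  rewrite -[RHS]low -[RHS](card_imset _ (@rev_ord_inj n)); apply: eq_card => x.
  rewrite inE; apply/idP/imsetP => [xe|[y]].
    exists (rev_ord x); last by rewrite rev_ordK.
    by rewrite inE /=; have := ltn_ord x; lia.
  by rewrite inE => ye -> /=; have := ltn_ord y; lia.
pose F (a : 'I_L) : {set 'I_n} :=
  if (tau ord0 != ord0) || ~~ odd a then [set x : 'I_n | x < e]
  else [set x : 'I_n | n <= x + e].
have cF : #|[set t : {ffun 'I_L -> 'I_n} | [forall c, t c \in F c]]| = e ^ L.
  rewrite card_family_prod (eq_bigr (fun=> e)) ?prod_nat_const ?card_ord //.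
  by move=> a _; rewrite /F; case: ifP.
have := card_not_injective L 'I_n; rewrite card_ord => h.
apply: leq_trans (leq_add (leqnn _) h).
rewrite -cF; apply: leq_trans (leq_card_setU _ _).
apply/subset_leq_card/subsetP => t; rewrite !inE => /forallP tF.
case: (injectiveb t) => //=; rewrite orbF; apply/forallP => a.
by have := tF a; rewrite /F; case: ifP; rewrite inE.
Qed.

Local Open Scope ring_scope.

(** Cauchy-Schwarz for the covariance of [x] with a centered statistic [y]. *)
Lemma variance_ge (R : realFieldType) (I : finType) (A : {set I})
    (x y : I -> R) (m Q : R) :
  0 < Q -> \sum_(i in A) y i = 0 -> \sum_(i in A) y i ^+ 2 <= Q ->
  (\sum_(i in A) x i * y i) ^+ 2 / Q <= \sum_(i in A) (x i - m) ^+ 2.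
Proof.
move=> Q0 y0 yQ; set c := \sum_(i in A) x i * y i.
have : 0 <= \sum_(i in A) (x i - m - c / Q * y i) ^+ 2.
  by apply: sumr_ge0 => i _; apply: sqr_ge0.
have -> : \sum_(i in A) (x i - m - c / Q * y i) ^+ 2 =
  \sum_(i in A) (x i - m) ^+ 2 - 2 * (c / Q) * (c - m * \sum_(i in A) y i) +
  (c / Q) ^+ 2 * \sum_(i in A) y i ^+ 2.
  rewrite /c !mulr_sumr -!sumrB mulr_sumr -sumrB -big_split /=.
  by apply: eq_bigr => i _; ring.
rewrite y0 mulr0 subr0 => h.
have h2 : (c / Q) ^+ 2 * \sum_(i in A) y i ^+ 2 <= (c / Q) ^+ 2 * Q.
  by rewrite ler_wpM2l // sqr_ge0.
have e2 : (c / Q) ^+ 2 * Q = c ^+ 2 / Q by field; rewrite gt_eqF.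
have e3 : 2 * (c / Q) * c = 2 * (c ^+ 2 / Q) by field; rewrite gt_eqF.
move: h h2; rewrite e2 e3; lra.
Qed.

Section Statistic.
Variables (R : realFieldType) (n L k e : nat) (C : {set 'S_n}) (tau : 'S_k.+2).
Hypothesis CJ : forall s r : 'S_n, s \in C -> (s ^ r)%g \in C.

Local Notation T := (injections L.+1 n).
Local Notation G := (corner_cycles L.+1 n e tau).
Local Notation tupL := {ffun 'I_L.+1 -> 'I_n}.

(** The proportion of corner cycles among all tuples of distinct labels is
    subtracted to make the total weight vanish. *)
Definition corner_density : R := #|G|%:R / #|T|%:R.

Definition weight (t : tupL) : R := (t \in G)%:R - corner_density.
(** The number of tuples that are cycles of [s] located in the corners, minus the
    multiple of the number of all cycles that makes the mean zero. *)
Definition corner_excess (s : 'S_n) : R :=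
  \sum_(t in T) weight t * (is_cycle s t)%:R.

Lemma corner_sub : G \subset T.
Proof. by apply/subsetP => t; rewrite inE => /andP[]. Qed.

Lemma corner_densityE : corner_density * #|T|%:R = #|G|%:R.
Proof.
rewrite /corner_density; case: (posnP #|T|) => [T0|Tp].
  have : (#|G| <= 0)%N by rewrite -T0 subset_leq_card // corner_sub.
  by rewrite leqn0 => /eqP->; rewrite !mul0r.
by rewrite divfK // pnatr_eq0 -lt0n.
Qed.

Lemma corner_density_ge0 : 0 <= corner_density.
Proof. by rewrite divr_ge0. Qed.

Lemma corner_density_le1 : corner_density <= 1.
Proof.
rewrite /corner_density; case: (posnP #|T|) => [->|Tp].
  by rewrite invr0 mulr0.
by rewrite ler_pdivrMr ?ltr0n // mul1r ler_nat subset_leq_card // corner_sub.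
Qed.

Lemma weight_le1 t : `|weight t| <= 1.
Proof.
have h0 := corner_density_ge0; have h1 := corner_density_le1.
by rewrite ler_norml /weight; case: (t \in G) => /=; lra.
Qed.

Lemma sum_weight (F : tupL -> R) :
  \sum_(t in T) weight t * F t =
  \sum_(t in G) F t - corner_density * \sum_(t in T) F t.
Proof.
rewrite mulr_sumr [X in X - _](_ : _ = \sum_(t in T) (t \in G)%:R * F t).
  by rewrite -sumrB; apply: eq_bigr => t _; rewrite mulrBl.
rewrite [RHS](big_setID G) /= (setIidPr corner_sub) [X in _ = _ + X]big1 ?addr0.
  by apply: eq_bigr => t ->; rewrite mul1r.
by move=> t; rewrite inE => /andP[/negPf-> _]; rewrite mul0r.
Qed.

Lemma sum_weight0 : \sum_(t in T) weight t = 0.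
Proof.
have := sum_weight (fun=> 1); under eq_bigr do rewrite mulr1.
by move=> ->; rewrite !sumr_const -[1 *+ #|T|]/(_%:R) corner_densityE subrr.
Qed.

Lemma sum_weight_const (F : tupL -> R) :
  {in T &, forall t u, F t = F u} -> \sum_(t in T) weight t * F t = 0.
Proof.
move=> Fc; have [t0 t0T|no] := pickP (mem T); last by rewrite big_pred0.
rewrite (eq_bigr (fun t => weight t * F t0)) => [|t tT]; last first.
  by rewrite (Fc t t0).
by rewrite -mulr_suml sum_weight0 mul0r.
Qed.

Lemma class_cycle_constT :
  {in T &, forall t u, \sum_(s in C) is_cycle s t = \sum_(s in C) is_cycle s u}%N.
Proof. by move=> t u; rewrite !inE => ti ui; apply: class_cycle_const. Qed.

Lemma sum_corner_excess : \sum_(s in C) corner_excess s = 0.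
Proof.
rewrite exchange_big /=.
rewrite -[RHS](@sum_weight_const (fun t => (\sum_(s in C) is_cycle s t)%N%:R)).
  by apply: eq_bigr => t _; rewrite natr_sum mulr_sumr.
by move=> t u tT uT; rewrite (class_cycle_constT tT uT).
Qed.

Definition pair_count (t u : tupL) : nat :=
  (\sum_(s in C) (is_cycle s t && is_cycle s u))%N.

Lemma sum_is_cycle (s : 'S_n) :
  (\sum_(t in T) is_cycle s t = #|[set t : tupL | is_cycle s t]|)%N.
Proof.
rewrite -sum1dep_card [RHS]big_mkcond [LHS]big_mkcond /=.
apply: eq_bigr => t _; rewrite inE /is_cycle.
by case: (injectiveb t) => //=; case: forallP.
Qed.

Lemma sum_pair_touching_le :
  (\sum_(t in T) \sum_(u in T | touch t u) pair_count t u <= #|C| * (n * L.+1))%N.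
Proof.
rewrite (eq_bigr (fun t : tupL => \sum_(s in C) \sum_(u in T | touch t u)
    (is_cycle s t && is_cycle s u)))%N; last first.
  by move=> t _; rewrite exchange_big.
rewrite exchange_big /= -sum_nat_const; apply: leq_sum => s _.
apply: (@leq_trans (\sum_(t in T) is_cycle s t * L.+1)); last first.
  by rewrite -big_distrl /= leq_mul2r sum_is_cycle card_is_cycle_le orbT.
apply: leq_sum => t _; case ct: (is_cycle s t) => /=; last first.
  by rewrite big1.
rewrite mul1n; apply: leq_trans (card_is_cycle_meeting ct).
rewrite -sum1dep_card big_mkcond [leqRHS]big_mkcond /=.
apply: leq_sum => u _.
by case: ifP => // /andP[_ ->]; rewrite andbT; case: is_cycle.
Qed.

Lemma sum_pair_le :
  (\sum_(t in T) \sum_(u in T) pair_count t u <= #|C| * n ^ 2)%N.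
Proof.
rewrite (eq_bigr (fun t : tupL => \sum_(s in C) \sum_(u in T)
    (is_cycle s t && is_cycle s u)))%N; last first.
  by move=> t _; rewrite exchange_big.
rewrite exchange_big /= -sum_nat_const; apply: leq_sum => s _.
apply: (@leq_trans ((\sum_(t in T) is_cycle s t) * \sum_(u in T) is_cycle s u)).
  rewrite big_distrlr /=; apply: leq_sum => t _; apply: leq_sum => u _.
  by case: is_cycle => //; rewrite mul1n.
by rewrite sum_is_cycle -mulnn leq_mul ?card_is_cycle_le.
Qed.

(** The variance of [corner_excess] is of order [n]. Each pair of disjoint tuples
    consists of two cycles equally often, and the weights sum to zero, so the
    disjoint pairs contribute minus what the pairs sharing a label would with the
    same frequency; there are only [O(n ^ (2 * L.+1 - 1))] of the latter. *)
Lemma sum_corner_excess_sqr :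
  (4 * L.+1 ^ 2 <= n)%N ->
  \sum_(s in C) corner_excess s ^+ 2 <=
  (L.+1 + 2 * L.+1 ^ 2)%:R * #|C|%:R * n%:R.
Proof.
move=> nL.
have n0 : (0 < n)%N by apply: leq_trans nL; rewrite muln_gt0 expn_gt0.
have ctouch (t : tupL) :
    (\sum_(u in T | touch t u) 1 <= L.+1 ^ 2 * n ^ L)%N.
  have := card_touch_le t; rewrite subn1 /=; apply: leq_trans.
  by rewrite sum1dep_card; apply/eq_leq/eq_card => u; rewrite !inE.
(* [b] is the number of times that a given disjoint pair consists of cycles *)
have [b [bE bD]] : exists b, {in T &, forall t u, ~~ touch t u ->
      pair_count t u = b} /\
    (b * \sum_(t in T) \sum_(u in T | ~~ touch t u) 1 <= #|C| * n ^ 2)%N.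
  have [[t0 u0] /= /and3P[tT uT tu]|no] := pickP (fun q : tupL * tupL =>
      [&& q.1 \in T, q.2 \in T & ~~ touch q.1 q.2]).
    exists (pair_count t0 u0).
    have cE : {in T &, forall t u, ~~ touch t u ->
        pair_count t u = pair_count t0 u0}.
      move: tT uT; rewrite !inE => t0i u0i t u; rewrite !inE => ti ui ntu.
      exact: class_pair_const.
    split=> //; apply: leq_trans sum_pair_le.
    rewrite big_distrr /=; apply: leq_sum => t tT'.
    rewrite big_distrr /= [leqRHS](bigID (touch t)) /=.
    apply: leq_trans (leq_addl _ _); apply: eq_leq; apply: eq_bigr.
    by move=> u /andP[uT' ntu]; rewrite muln1 cE.
  exists 0%N; split; last by rewrite mul0n.
  by move=> t u tT uT tu; have := no (t, u); rewrite /= tT uT tu.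
have bT : (b * #|T| * (L.+1 ^ 2 * n ^ L) <= 2 * L.+1 ^ 2 * #|C| * n)%N.
  have D1 : (#|T| * n ^ L.+1 <=
      2 * \sum_(t in T) \sum_(u in T | ~~ touch t u) 1)%N.
    rewrite -sum_nat_const big_distrr /=; apply: leq_sum => t _.
    have tot : (\sum_(u in T | touch t u) 1 + \sum_(u in T | ~~ touch t u) 1
        = #|T|)%N by rewrite -bigID sum1_card.
    have := card_injections_ge L.+1 n; rewrite subn1 /= => Tge.
    have : (4 * L.+1 ^ 2 * n ^ L <= n ^ L.+1)%N.
      by rewrite [(n ^ L.+1)%N]expnS leq_mul2r nL orbT.
    move: (ctouch t) tot Tge; rewrite -mulnA.
    set A1 := (\sum_(u in T | touch t u) 1)%N; set A2 := (\sum_(u in T | ~~ _) 1)%N.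
    move: (n ^ L.+1)%N (L.+1 ^ 2 * n ^ L)%N #|T|; lia.
  rewrite -(leq_pmul2r n0).
  apply: (@leq_trans (L.+1 ^ 2 * (b * (#|T| * n ^ L.+1)))).
    by rewrite [(n ^ L.+1)%N]expnS; apply: eq_leq; ring.
  apply: (@leq_trans (L.+1 ^ 2 * (b * (2 *
      \sum_(t in T) \sum_(u in T | ~~ touch t u) 1)))).
    by rewrite !leq_mul2l D1 !orbT.
  apply: (@leq_trans (L.+1 ^ 2 * (2 * (#|C| * n ^ 2)))).
    by rewrite leq_mul2l [(b * _)%N]mulnCA leq_mul2l bD !orbT.
  by apply: eq_leq; ring.
have -> : \sum_(s in C) corner_excess s ^+ 2 =
    \sum_(t in T) \sum_(u in T) weight t * weight u * (pair_count t u)%:R.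
  rewrite (eq_bigr (fun s : 'S_n => \sum_(t in T) \sum_(u in T)
      weight t * weight u * (is_cycle s t && is_cycle s u)%:R)); last first.
    move=> s _; rewrite expr2 /corner_excess big_distrlr /=.
    apply: eq_bigr => t _; apply: eq_bigr => u _.
    by rewrite mulrACA -natrM mulnb.
  rewrite exchange_big /=; apply: eq_bigr => t _.
  rewrite exchange_big /=; apply: eq_bigr => u _.
  by rewrite -mulr_sumr -natr_sum.
rewrite (eq_bigr (fun t : tupL =>
   \sum_(u in T | touch t u) weight t * weight u * (pair_count t u)%:R +
   \sum_(u in T | ~~ touch t u) weight t * weight u * (pair_count t u)%:R));
  last by move=> t _; rewrite -bigID.
rewrite big_split /= natrD mulrDl mulrDl; apply: lerD.
  rewrite -mulrA mulrC -mulrA -!natrM.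
  apply: (@le_trans _ _ ((\sum_(t in T) \sum_(u in T | touch t u)
     pair_count t u)%N%:R)); last by rewrite ler_nat sum_pair_touching_le.
  rewrite natr_sum; apply: ler_sum => t _; rewrite natr_sum; apply: ler_sum => u _.
  rewrite -[leRHS]mul1r ler_wpM2r // (le_trans (ler_norm _)) // normrM.
  by rewrite -[leRHS]mul1r ler_pM ?normr_ge0 ?weight_le1.
rewrite -!natrM; apply: (@le_trans _ _ ((b * #|T| * (L.+1 ^ 2 * n ^ L))%N%:R));
  last by rewrite ler_nat.
rewrite (_ : b * #|T| * _ = \sum_(t in T) b * (L.+1 ^ 2 * n ^ L))%N; last first.
  by rewrite sum_nat_const; ring.
rewrite natr_sum; apply: ler_sum => t tT.
have -> : \sum_(u in T | ~~ touch t u) weight t * weight u * (pair_count t u)%:R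
    = - (weight t * b%:R) * \sum_(u in T | touch t u) weight u.
  have /eqP := sum_weight0; rewrite (bigID (touch t)) /= addr_eq0 => /eqP ->.
  rewrite mulrNN mulr_sumr; apply: eq_bigr => u /andP[uT tu].
  by rewrite bE // mulrAC.
apply: (le_trans (ler_norm _)); rewrite normrM normrN normrM [`|b%:R|]ger0_norm //.
rewrite natrM -mulrA -[leRHS]mul1r; apply: ler_pM; rewrite ?mulr_ge0 ?weight_le1 //.
rewrite ler_wpM2l //; apply: le_trans (ler_norm_sum _ _ _) _.
apply: (@le_trans _ _ ((\sum_(u in T | touch t u) 1)%N%:R)); last first.
  by rewrite ler_nat.
by rewrite natr_sum; apply: ler_sum => u _; apply: weight_le1.
Qed.

(** The occurrences off a cycle are, on average over the class, unaffected by
    where the cycle is, so weights of sum zero cancel them and only the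
    occurrences using the cycle remain. *)
Lemma sum_nocc_corner_excess :
  \sum_(s in C) (nocc tau s)%:R * corner_excess s =
  \sum_(t in G) (\sum_(s in C) is_cycle s t * occ_at tau s t)%N%:R -
  corner_density *
    (\sum_(s in C) \sum_(t : tupL) is_cycle s t * occ_at tau s t)%N%:R.
Proof.
have -> : (\sum_(s in C) \sum_(t : tupL) is_cycle s t * occ_at tau s t =
    \sum_(t in T) \sum_(s in C) is_cycle s t * occ_at tau s t)%N.
  rewrite [RHS]exchange_big; apply: eq_bigr => s _; rewrite [RHS]big_mkcond /=.
  apply: eq_bigr => t _; rewrite inE; case: ifP => // /negbT nt.
  by rewrite /is_cycle (negPf nt).
rewrite natr_sum -sum_weight.
transitivity (\sum_(t in T) weight t *
    (\sum_(s in C) is_cycle s t * nocc tau s)%N%:R).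
  rewrite (eq_bigr (fun s : 'S_n => \sum_(t in T)
      (nocc tau s)%:R * (weight t * (is_cycle s t)%:R))); last first.
    by move=> s _; rewrite mulr_sumr.
  rewrite exchange_big /=; apply: eq_bigr => t _.
  rewrite natr_sum mulr_sumr; apply: eq_bigr => s _.
  by rewrite natrM mulrCA [X in _ * X]mulrC.
rewrite -[RHS]addr0 -[X in _ = _ + X](@sum_weight_const (fun t =>
   (\sum_(s in C) is_cycle s t * occ_off tau s t)%N%:R)); last first.
  move=> t u; rewrite !inE => ti ui.
  by rewrite (class_off_const CJ tau ti ui).
rewrite -big_split /=; apply: eq_bigr => t _.
rewrite -mulrDr -natrD -big_split /=; congr (_ * _%:R); apply: eq_bigr => s _.
by rewrite -mulnDr -nocc_split.
Qed.

(** Corner cycles are used by few occurrences, while a cycle placed anywhere is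
    used by many: the two quantities have a negative covariance. *)
Lemma sum_nocc_corner_excess_le :
  odd L ->
  corner_density *
    ((\sum_(s in C) \sum_(t : tupL) is_cycle s t * occ_at tau s t)%N%:R -
     (#|C| * n * (L.+1 * k.+2 ^ 2 * (4 * e * n ^ k)))%N%:R) <=
  - \sum_(s in C) (nocc tau s)%:R * corner_excess s.
Proof.
move=> oL; rewrite sum_nocc_corner_excess opprB mulrBr lerD2l lerN2.
set M := (L.+1 * k.+2 ^ 2 * (4 * e * n ^ k))%N.
apply: (@le_trans _ _ (\sum_(t in G) ((\sum_(s in C) is_cycle s t) * M)%N%:R)).
  apply: ler_sum => t; rewrite inE => /andP[_ cor]; rewrite ler_nat big_distrl /=.
  apply: leq_sum => s _; case ct: (is_cycle s t) => //.
  by rewrite !mul1n occ_at_corner.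
have [t0 t0G|no] := pickP (mem G); last first.
  by rewrite big_pred0 // mulr_ge0 ?corner_density_ge0.
have t0T : t0 \in T by apply: (subsetP corner_sub).
pose c := (\sum_(s in C) is_cycle s t0)%N.
have cT : (#|T| * c <= #|C| * n)%N.
  rewrite -sum_nat_const -sum_nat_const.
  rewrite (eq_bigr (fun t : tupL => \sum_(s in C) is_cycle s t)%N); last first.
    by move=> t tT; apply: class_cycle_constT.
  rewrite exchange_big /=; apply: leq_sum => s _.
  by rewrite sum_is_cycle card_is_cycle_le.
rewrite (eq_bigr (fun=> (c * M)%N%:R)); last first.
  by move=> t /(subsetP corner_sub) tT; rewrite (class_cycle_constT tT t0T).
rewrite sumr_const -[_ *+ #|_|]mulr_natl -corner_densityE -mulrA.
rewrite ler_wpM2l ?corner_density_ge0 //.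
by rewrite -natrM ler_nat mulnA leq_mul2r cT orbT.
Qed.

End Statistic.

(** * The lower bound on the variance *)

(** The exponent is [2 * k.+2 - 1] for a pattern of size [k.+2]. The corners have
    side [n %/ r], with [r] so large that corner cycles are used by at most half
    as many occurrences as an average cycle. *)
Lemma class_variance_ge (R : realFieldType) (L k q : nat) (tau : 'S_k.+2) :
  odd L -> (0 < q)%N ->
  exists2 c : R, 0 < c & exists n0 : nat, forall n (C : {set 'S_n}) (m : R),
    (n0 <= n)%N ->
    (forall s r : 'S_n, s \in C -> (s ^ r)%g \in C) ->
    (forall s, s \in C -> (n <= q * #|cycle_labels L.+1 s|)%N) ->
    c * #|C|%:R * n%:R ^+ (2 * k + 3) <=
      \sum_(s in C) ((nocc tau s)%:R - m) ^+ 2.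
Proof.
move=> oL q0; have L0 : (0 < L)%N by case: L oL.
pose K := k.+2.
(* an average cycle is used by at least about [n ^ (K - 1) / W] occurrences, and
   the corner cycles have density at least [1 / V] *)
pose W := (2 * (2 * q) ^ K * (K + K)`!)%N.
have W0 : (0 < W)%N.
  by rewrite muln_gt0 fact_gt0 andbT muln_gt0 expn_gt0 muln_gt0 q0.
pose r := (8 * (L.+1 * K ^ 2) * W)%N.
have r0 : (0 < r)%N by rewrite muln_gt0 W0 andbT.
pose V := (2 * (2 * r) ^ L.+1)%N.
have V0 : (0 < V)%N by rewrite muln_gt0 expn_gt0 muln_gt0 r0.
pose D := (L.+1 + 2 * L.+1 ^ 2)%N.
have D0 : (0 < D)%N by [].
have Wp : 0 < W%:R :> R by rewrite ltr0n.
have Vp : 0 < V%:R :> R by rewrite ltr0n.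
have Dp : 0 < D%:R :> R by rewrite ltr0n.
exists ((4 * V%:R ^+ 2 * W%:R ^+ 2 * D%:R)^-1).
  by rewrite invr_gt0 !mulr_gt0 ?exprn_gt0.
exists (2 * q + 4 * K ^ 2 * (2 * q) ^ K + 2 * r + 2 * L.+1 ^ 2 * (2 * r) ^ L.+1
        + 4 * L.+1 ^ 2)%N.
move=> n C m n_big CJ CP.
have [n1 n2 n3 n4 n5] : [/\ 2 * q <= n, 4 * K ^ 2 * (2 * q) ^ K <= n, 2 * r <= n,
    2 * L.+1 ^ 2 * (2 * r) ^ L.+1 <= n & 4 * L.+1 ^ 2 <= n]%N.
  exact: leq_add5 n_big.
have n0 : (0 < n)%N by apply: leq_trans n5; rewrite muln_gt0 expn_gt0.
have np : 0 < n%:R :> R by rewrite ltr0n.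
have [C0|Cp] := posnP #|C|.
  by rewrite C0 mulr0 mul0r; apply: sumr_ge0 => s _; apply: sqr_ge0.
have CRp : 0 < #|C|%:R :> R by rewrite ltr0n.
pose e := (n %/ r)%N.
pose O := (\sum_(s in C) \sum_(t : {ffun 'I_L.+1 -> 'I_n})
             is_cycle s t * occ_at tau s t)%N.
have OW : (#|C| * n ^ K <= W * O)%N.
  have CP' s : s \in C -> (n %/ q <= #|cycle_labels L.+1 s|)%N.
    by move=> /CP sP; rewrite -(leq_pmul2l q0) (leq_trans _ sP) // mulnC leq_divM.
  have := class_sum_occ_at_ge tau L0 CJ CP'; rewrite -/O -/K.
  set Y := (_ - _)%N => YO.
  have nY : (n ^ K <= 2 * (2 * q) ^ K * Y)%N.
    have := leq_expn_double_divn K q0 n1.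
    have : (4 * K ^ 2 * (2 * q) ^ K * n ^ k.+1 <= n ^ K)%N.
      by rewrite [(n ^ K)%N]expnS leq_mul2r n2 orbT.
    rewrite /Y -[(2 * _ * _)%N]mulnA mulnBr => h1 h2; apply: leq_double_sub h2 _.
    by apply: leq_trans h1; apply: eq_leq; ring.
  apply: (@leq_trans (#|C| * (2 * (2 * q) ^ K * Y))).
    by rewrite leq_mul2l nY orbT.
  apply: (@leq_trans (2 * (2 * q) ^ K * (#|C| * Y))).
    by apply: eq_leq; ring.
  by rewrite /W -[leqRHS]mulnA leq_mul2l YO orbT.
pose M := (#|C| * n * (L.+1 * K ^ 2 * (4 * e * n ^ k)))%N.
have MW : (2 * W * M <= #|C| * n ^ K)%N.
  apply: (@leq_trans (#|C| * (r * e) * n ^ k.+1)).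
    by rewrite /M [(n ^ k.+1)%N]expnS; apply: eq_leq; rewrite /r; ring.
  rewrite [(n ^ K)%N]expnS [leqRHS]mulnA leq_mul2r leq_mul2l.
  by rewrite mulnC leq_divM !orbT.
have TV : (#|injections L.+1 n| <= V * #|corner_cycles L.+1 n e tau|)%N /\
    (0 < #|injections L.+1 n|)%N.
  have en : (e <= n)%N by apply: leq_div.
  have := leq_expn_double_divn L.+1 r0 n3; rewrite -/e.
  have := card_corner_cycles_ge L.+1 tau en; rewrite subn1 /= => h1 h2.
  have h3 : (2 * L.+1 ^ 2 * (2 * r) ^ L.+1 * n ^ L <= n ^ L.+1)%N.
    by rewrite [(n ^ L.+1)%N]expnS leq_mul2r n4 orbT.
  have h4 := card_injections_le L.+1 n.
  have h5 : (n ^ L.+1 <= V * #|corner_cycles L.+1 n e tau|)%N.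
    have : ((2 * r) ^ L.+1 * e ^ L.+1 <= (2 * r) ^ L.+1 *
       (#|corner_cycles L.+1 n e tau| + L.+1 ^ 2 * n ^ L))%N.
      by rewrite leq_mul2l h1 orbT.
    rewrite mulnDr /V -[(2 * _ * _)%N]mulnA => h6.
    apply: leq_double_add h2 h6 _.
    by apply: leq_trans h3; apply: eq_leq; ring.
  split; first by apply: leq_trans h5.
  apply: (@leq_trans #|corner_cycles L.+1 n e tau|); last first.
    by apply/subset_leq_card/corner_sub.
  have : (0 < n ^ L.+1)%N by rewrite expn_gt0 n0.
  by move=> /leq_trans/(_ h5); rewrite muln_gt0 => /andP[].
have gV : V%:R^-1 <= corner_density R n L e tau.
  case: TV => TV T0.
  rewrite /corner_density ler_pdivlMr ?ltr0n // mulrC ler_pdivrMr //.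
  by rewrite mulrC -natrM ler_nat.
have cov : #|C|%:R * n%:R ^+ K / (2 * V%:R * W%:R) <=
    - \sum_(s in C) (nocc tau s)%:R * corner_excess R L e tau s.
  apply: le_trans (sum_nocc_corner_excess_le R e tau CJ oL).
  rewrite -/O -/K -/M.
  have h1 : #|C|%:R * n%:R ^+ K <= W%:R * O%:R :> R.
    by rewrite -natrX -!natrM ler_nat.
  have h2 : 2 * W%:R * M%:R <= #|C|%:R * n%:R ^+ K :> R.
    by rewrite -natrX -!natrM ler_nat.
  have h3 : #|C|%:R * n%:R ^+ K / (2 * W%:R) <= O%:R - M%:R :> R.
    rewrite ler_pdivrMr ?mulr_gt0 //.
    by move: h1 h2; move: (#|C|%:R * n%:R ^+ K : R) => a; nra.
  apply: (@le_trans _ _ (V%:R^-1 * (#|C|%:R * n%:R ^+ K / (2 * W%:R)))).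
    by rewrite le_eqVlt; apply/orP; left; apply/eqP; field; rewrite !gt_eqF.
  apply: ler_pM => //; first by rewrite invr_ge0 ltW.
  by rewrite divr_ge0 // mulr_ge0 // ?exprn_ge0 ?mulr_ge0.
have Qp : 0 < D%:R * #|C|%:R * n%:R :> R by rewrite !mulr_gt0.
have := variance_ge (fun s => (nocc tau s)%:R) m Qp (sum_corner_excess R L e tau CJ)
  (sum_corner_excess_sqr R e tau CJ n5).
apply: le_trans.
rewrite ler_pdivlMr // -[X in _ <= X ^+ 2]opprK sqrrN.
apply: (@le_trans _ _ ((#|C|%:R * n%:R ^+ K / (2 * V%:R * W%:R)) ^+ 2)); last first.
  have cov0 : 0 <= #|C|%:R * n%:R ^+ K / (2 * V%:R * W%:R) :> R.
    apply: divr_ge0; last by rewrite !mulr_ge0.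
    by apply: mulr_ge0; last apply: exprn_ge0.
  by apply: lerXn2r; rewrite ?nnegrE ?(le_trans cov0 cov).
have e1 : (n%:R ^+ K) ^+ 2 = n%:R ^+ (2 * k + 3) * n%:R :> R.
  by rewrite -exprM -exprSr; congr (_ ^+ _); rewrite /K; clear; lia.
rewrite expr_div_n exprMn e1.
by rewrite le_eqVlt; apply/orP; left; apply/eqP; field; rewrite !gt_eqF.
Qed.

(** * The limit of the variance *)

From mathcomp Require Import all_classical all_reals all_analysis.
Import numFieldNormedType.Exports.

Lemma cvg_ratio (R : realType) (x : nat -> nat) (p a : R) :
  (forall n, `|(x n)%:R - p * n%:R| <= a) ->
  (((x n)%:R / n%:R : R) @[n --> \oo] --> p)%classic.
Proof.
move=> xa.
have lim (b : R) : ((p + b * harmonic n) @[n --> \oo] --> p)%classic.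
  suff : ((p + b * harmonic n) @[n --> \oo] --> p + b * 0)%classic.
    by rewrite mulr0 addr0.
  apply: cvgD; first exact: cvg_cst.
  by apply: cvgMl_tmp; apply: cvg_harmonic.
apply: (squeeze_cvgr _ (lim (- (2 * a))) (lim (2 * a))).
near=> n.
have n0 : (0 < n)%N by near: n; apply: nbhs_infty_gt.
have np : 0 < n%:R :> R by rewrite ltr0n.
have n1 : 1 <= n%:R :> R by rewrite ler1n.
have := xa n; rewrite ler_norml => /andP[h1 h2].
have a0 : 0 <= a by lra.
have hh : harmonic n = (n%:R + 1)^-1 :> R by rewrite /harmonic /= natr1.
rewrite hh ler_pdivlMr // ler_pdivrMr //.
have hp : 0 < (n%:R + 1)^-1 :> R by rewrite invr_gt0; lra.
have e : n%:R * (n%:R + 1)^-1 = 1 - (n%:R + 1)^-1 :> R by field; lra.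
have h3 : (n%:R + 1)^-1 <= 2^-1 :> R by rewrite lef_pV2 ?posrE; lra.
have e1 : (p - 2 * a * (n%:R + 1)^-1) * n%:R =
    p * n%:R - 2 * a * (n%:R * (n%:R + 1)^-1) by ring.
have e2 : (p + 2 * a * (n%:R + 1)^-1) * n%:R =
    p * n%:R + 2 * a * (n%:R * (n%:R + 1)^-1) by ring.
rewrite mulNr e1 e2 e; nra.
Unshelve. all: by end_near.
Qed.

Lemma truncn_linear_ge (R : realType) (p : R) : 0 < p ->
  exists2 q : nat, (0 < q)%N & forall n, (q <= n)%N ->
    (n <= q * Num.truncn (p * n%:R))%N.
Proof.
move=> p0; pose q0 := (Num.truncn (2 * p^-1)).+1.
have q0p : 2 * p^-1 < q0%:R.
  have h : 0 <= 2 * p^-1 by rewrite mulr_ge0 // invr_ge0 ltW.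
  by have /andP[_] := truncn_itv h.
exists q0 => // n qn.
have /andP[_] := truncn_itv (mulr_ge0 (ltW p0) (ler0n R n)).
rewrite -natr1 -(ler_nat R) natrM; move: (Num.truncn _) => t ht.
have h1 : 2 < q0%:R * p by rewrite -ltr_pdivrMr.
have h2 : q0%:R <= n%:R :> R by rewrite ler_nat.
have h3 : q0%:R * (p * n%:R) <= q0%:R * (t%:R + 1).
  by rewrite ler_wpM2l // ltW.
have h4 : 2 * n%:R <= q0%:R * p * n%:R by rewrite ler_wpM2r // ltW.
lra.
Qed.

Lemma moment2_dirac0 (R : realType) (v : R) : v <= 0 ->
  Rintegral (centered_normal v) setT (fun x => x ^+ 2) = 0.
Proof.
move=> v0; rewrite /centered_normal ltNge v0 /= /Rintegral integral_dirac //.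
  by rewrite expr0n /= mulr0n mulr0.
apply/measurable_realfun.measurable_EFinP.
exact: (@measurable_realfun.exprn_measurable R setT 2).
Qed.

Lemma class_mean_normalized_sqr (R : realType) (n k : nat) (tau : 'S_k.+2)
    (lam : intpart n) :
  class_mean lam (fun s => normalized_nocc R tau lam s ^+ 2) =
  (\sum_(s in cycle_class lam)
     ((nocc tau s)%:R - class_mean lam (fun s' => (nocc tau s')%:R)) ^+ 2) /
  n%:R ^+ (2 * k + 3) / #|cycle_class lam|%:R.
Proof.
rewrite /class_mean; congr (_ / _); rewrite mulr_suml; apply: eq_bigr => s _.
rewrite /normalized_nocc expr_div_n; congr (_ / _).
rewrite -powR_mulrn ?powR_ge0 // -powRrM.
rewrite (_ : _ * _ = (2 * k + 3)%:R) ?powR_mulrn //.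
by rewrite natrD natrM -addn2 natrD; lra.
Qed.

(** A density [(1 - p1 - 2 * p2) / 4] of 4-cycles fills up what fixed points and
    2-cycles leave, and by itself does not affect the two prescribed densities. *)
Lemma partitions_exist (R : realType) (p1 p2 : R) :
  0 <= p1 -> 0 <= p2 -> p1 + 2 * p2 <= 1 ->
  exists lam : forall n, intpart n, forall n,
    [/\ (mult 1 (lam n) + (4 * mult 4 (lam n) + 2 * mult 2 (lam n)))%N = n,
        mult 2 (lam n) = Num.truncn (p2 * n%:R),
        mult 4 (lam n) = Num.truncn ((1 - p1 - 2 * p2) / 4 * n%:R) &
        (0 < #|cycle_class (lam n)|)%N].
Proof.
move=> p1_ge0 p2_ge0 hp.
suff H n : exists lam : intpart n,
    [/\ (mult 1 lam + (4 * mult 4 lam + 2 * mult 2 lam))%N = n,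
        mult 2 lam = Num.truncn (p2 * n%:R),
        mult 4 lam = Num.truncn ((1 - p1 - 2 * p2) / 4 * n%:R) &
        (0 < #|cycle_class lam|)%N].
  by exists (fun n => projT1 (cid (H n))) => n; apply: (projT2 (cid (H n))).
set p4 := (1 - p1 - 2 * p2) / 4.
have p4_ge0 : 0 <= p4 by rewrite /p4; lra.
have n_ge0 : 0 <= n%:R :> R by [].
have uv : (4 * Num.truncn (p4 * n%:R) + 2 * Num.truncn (p2 * n%:R) <= n)%N.
  have /andP[h4 _] := truncn_itv (mulr_ge0 p4_ge0 n_ge0).
  have /andP[h2 _] := truncn_itv (mulr_ge0 p2_ge0 n_ge0).
  rewrite -(ler_nat R) natrD !natrM.
  have : 4 * (p4 * n%:R) + 2 * (p2 * n%:R) <= n%:R.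
    have -> : 4 * (p4 * n%:R) + 2 * (p2 * n%:R) = (1 - p1) * n%:R.
      by rewrite /p4; field.
    by nra.
  lra.
have [s [s4 s2 s1]] := block_perm_exists uv.
have [lam slam] := cycle_type_exists s; exists lam.
have /cycle_classP e := slam.
have e4 := e 4%N; have e2 := e 2%N; have e1 := e 1%N; split; try lia.
by apply/card_gt0P; exists s.
Qed.

Theorem theorem2 (R : realType) (k : nat) (tau : 'S_k) (f g : {poly R})
    (hk : (2 <= k)%N) (hfg : associated_polys tau f g) (p1 p2 : R)
    (hp1 : 0 <= p1) (hp2 : 0 <= p2) (hp : p1 + 2 * p2 <= 1)
    (hne : (p1, p2) <> (1, 0)) :
  0 < f.[p1] + p2 * g.[p1].
Proof.
rewrite ltNge; apply/negP => v_le0.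
case: k hk tau hfg => [|[|k]] // _ tau hfg.
have [lam lamP] := partitions_exist hp1 hp2 hp.
set p4 := (1 - p1 - 2 * p2) / 4 in lamP.
have p4_ge0 : 0 <= p4 by rewrite /p4; lra.
have m2E n : `|(mult 2 (lam n))%:R - p2 * n%:R| <= 1.
  have [_ -> _ _] := lamP n.
  have /andP[] := truncn_itv (mulr_ge0 hp2 (ler0n R n)).
  by rewrite -natr1 ler_norml => h1 h2; apply/andP; split; lra.
have m4E n : `|(mult 4 (lam n))%:R - p4 * n%:R| <= 1.
  have [_ _ -> _] := lamP n.
  have /andP[] := truncn_itv (mulr_ge0 p4_ge0 (ler0n R n)).
  by rewrite -natr1 ler_norml => h1 h2; apply/andP; split; lra.
have m1E n : `|(mult 1 (lam n))%:R - p1 * n%:R| <= 6.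
  have [/(congr1 (fun m => m%:R : R)) + _ _ _] := lamP n.
  rewrite /= natrD natrD natrM natrM => tot.
  have := m2E n; have := m4E n; rewrite !ler_norml => /andP[h1 h2] /andP[h3 h4].
  have e0 : n%:R = 4 * (p4 * n%:R) + 2 * (p2 * n%:R) + p1 * n%:R :> R.
    by rewrite /p4; field.
  by apply/andP; split; lra.
have [_ /(_ 2%N)] := hfg p1 p2 lam (cvg_ratio m1E) (cvg_ratio m2E).
rewrite moment2_dirac0 // => cvg0.
(* the cycles of length [L.+1] are the 2-cycles if [p2 > 0], else the 4-cycles *)
have [L [q [oL q0 Lq]]] : exists L q, [/\ odd L, (0 < q)%N & forall n, (q <= n)%N ->
    forall s, s \in cycle_class (lam n) -> (n <= q * #|cycle_labels L.+1 s|)%N].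
  have labels d n s : s \in cycle_class (lam n) ->
      (mult d.+1 (lam n) <= #|cycle_labels d.+1 s|)%N.
    by move=> /cycle_classP <-; apply: leq_pmulr.
  have [p2p|p2z] : 0 < p2 \/ p2 = 0.
    by move: hp2; rewrite le_eqVlt => /orP[/eqP<-|]; [right|left].
  - have [q q0 qP] := truncn_linear_ge p2p; exists 1%N, q; split=> // n qn s sn.
    apply: (leq_trans (qP n qn)); rewrite leq_mul2l.
    by have [_ <- _ _] := lamP n; rewrite labels ?orbT.
  have p4p : 0 < p4.
    rewrite lt_neqAle p4_ge0 andbT eq_sym; apply/eqP => p40; apply: hne.
    by rewrite p2z; congr (_, _); move: p40; rewrite /p4 p2z; lra.
  have [q q0 qP] := truncn_linear_ge p4p; exists 3%N, q; split=> // n qn s sn.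
  apply: (leq_trans (qP n qn)); rewrite leq_mul2l.
  by have [_ _ <- _] := lamP n; rewrite labels ?orbT.
have [c c0 [n0 varP]] := class_variance_ge R tau oL q0.
suff : c <= 0 by rewrite leNgt c0.
apply: (cvgr_to_ge cvg0); near=> n.
have n_ge : (maxn n0 (maxn q 1) <= n)%N by near: n; apply: nbhs_infty_ge.
move: n_ge; rewrite !geq_max => /and3P[n0n qn n_gt0].
have [_ _ _ Cp] := lamP n.
rewrite class_mean_normalized_sqr ler_pdivlMr ?ltr0n // ler_pdivlMr; last first.
  by rewrite exprn_gt0 // ltr0n.
apply: varP => //; last exact: Lq.
by move=> s r; apply: cycle_classJ.
Unshelve. all: by end_near.
Qed.
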